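(* Let $\mathcal M=(\mathcal D,\mathrm x)$ be a minimal time-like surface in $\mathbb R^n_1$ given in canonical coordinates $(u,v)$. Let $(X_1,X_2)$ be the orthonormal tangent basis with $X_1=\mathrm x_u/\sqrt{-E}$, $X_2=\mathrm x_v/\sqrt{-E}$, and suppose that $\sigma(X_1,X_1)$ and $\sigma(X_1,X_2)$ are not zero. Put $\nu=\|\sigma(X_1,X_1)\|>0$, $\mu=\|\sigma(X_1,X_2)\|>0$, $\mathrm n_1=\sigma(X_1,X_1)/\nu$, $\mathrm n_2=\sigma(X_1,X_2)/\mu$ and $\varkappa=R^N(X_1,X_2)\mathrm n_1\cdot\mathrm n_2$. Then $\mathrm n_1\bot\mathrm n_2$; the vector $\sigma(X_1,X_1)$ lies on the real axis of the hyperbola $\mathscr H_p$ of the normal curvature and $\nu$ is the length of its real semi-axis; the vector $\sigma(X_1,X_2)$ lies on the conjugate axis of $\mathscr H_p$ and $\mu$ is the length of its conjugate semi-axis; and $$K=-\nu^2+\mu^2,\qquad \varkappa=\pm2\nu\mu,\qquad E=\frac{-1}{\sqrt{\mu^2+\nu^2}}=\frac{-1}{\sqrt[4]{K^2+\varkappa^2}},$$ where $K$ is the Gauss curvature of $\mathcal M$.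
   Context: Double numbers: $\mathbb D=\{t=u+\mathrm j v:\ u,v\in\mathbb R\}$ with $\mathrm j^2=1$. Put $\frac{\partial}{\partial t}=\frac12\left(\frac{\partial}{\partial u}+\mathrm j\frac{\partial}{\partial v}\right)$. Space: $\mathbb R^n_1$ is $\mathbb R^n$ with $a\cdot b=-a_1b_1+a_2b_2+\dots+a_nb_n$, and $\mathbb D^n_1=\mathbb D^n$ carries the $\mathbb D$-bilinear extension of this product; $a^2=a\cdot a$. Surfaces: a time-like surface $\mathcal M=(\mathcal D,\mathrm x)$ in $\mathbb R^n_1$ is given by a smooth immersion $\mathrm x(u,v):\mathcal D\to\mathbb R^n_1$ of a domain $\mathcal D\subset\mathbb R^2\cong\mathbb D$ (via $t=u+\mathrm jv$) whose induced metric is indefinite. $E=\mathrm x_u^2$, $F=\mathrm x_u\cdot\mathrm x_v$, $G=\mathrm x_v^2$; coordinates $(u,v)$ are isothermal if $E=-G$, $F=0$, ordered so that $E<0$. $T_p(\mathcal M)$ is the tangent space, $N_p(\mathcal M)$ its orthogonal complement in $\mathbb R^n_1$ (positive definite, so $\|\xi\|=\sqrt{\xi\cdot\xi}$ for $\xi\in N_p(\mathcal M)$); $a^\bot$ is the orthogonal projection of $a\in\mathbb D^n_1$ to the $\mathbb D$-linear span of $N_p(\mathcal M)$. With $\nabla$ the canonical flat connection, $\sigma(X,Y)=(\nabla_XY)^\bot$ is the second fundamental form, $\nabla^N$ the normal connection, and $R^N(X,Y)\mathrm n=\nabla^N_X\nabla^N_Y\mathrm n-\nabla^N_Y\nabla^N_X\mathrm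 n-\nabla^N_{[X,Y]}\mathrm n$. For an orthonormal tangent basis with $X_1^2=-1$, $X_2^2=1$: $\mathrm H=\frac12(-\sigma(X_1,X_1)+\sigma(X_2,X_2))$ and $K=-R(X_1,X_2)X_2\cdot X_1=-\sigma(X_1,X_1)\cdot\sigma(X_2,X_2)+\sigma^2(X_1,X_2)$, where $R(X,Y)Z=\nabla^T_X\nabla^T_YZ-\nabla^T_Y\nabla^T_XZ-\nabla^T_{[X,Y]}Z$ is the curvature tensor of the Levi-Civita connection $\nabla^T$ of $\mathcal M$. $\mathcal M$ is minimal if $\mathrm H=0$ everywhere. Canonical coordinates: isothermal coordinates with $E<0$ on a minimal time-like surface such that $\Phi=2\frac{\partial\mathrm x}{\partial t}=\mathrm x_u+\mathrm j\,\mathrm x_v$ and $\Phi'=\frac{\partial\Phi}{\partial t}$ satisfy $\Phi'^\bot\cdot\Phi'^\bot=1$. Hyperbola of the normal curvature: for a minimal time-like surface such that $\sigma(X_1,X_1)$ and $\sigma(X_1,X_2)$ are linearly independent, the set $\{\sigma(X,X): X\in T_p(\mathcal M),\ X^2=1\}=\{\sigma(X_1,X_1)\cosh 2\psi+\sigma(X_1,X_2)\sinh2\psi:\psi\in\mathbb R\}$ is a branch of a hyperbola with center $0$ in the (Euclidean) normal plane spanned by $\sigma(X_1,X_1)$ and $\sigma(X_1,X_2)$; this hyperbola is $\mathscr H_p$. *)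

(* Defs.v *)
From HB Require Import structures.
From mathcomp Require Import all_boot all_order all_algebra ring.
From mathcomp Require Import all_classical all_reals all_analysis.

Set Implicit Arguments.
Unset Strict Implicit.
Unset Printing Implicit Defensive.

Import Order.TTheory GRing.Theory Num.Theory.
Import numFieldNormedType.Exports.

Local Open Scope classical_set_scope.
Local Open Scope ring_scope.

(** * Double numbers [u + j v], [j ^ 2 = 1] *)

(* A fresh record rather than [R * R], whose library ring structure is the
   componentwise one. *)
Record dnum (R : Type) := DNum { dre : R; dim : R }.

Definition dnum_pair (R : Type) (t : dnum R) : R * R := (dre t, dim t).
Definition pair_dnum (R : Type) (t : R * R) : dnum R := DNum t.1 t.2.
Lemma dnum_pairK (R : Type) : cancel (@dnum_pair R) (@pair_dnum R).
Proof. by case. Qed.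

HB.instance Definition _ (R : choiceType) := Choice.copy (dnum R)
  (can_type (@dnum_pairK R)).

Section DnumRing.
Variable R : comNzRingType.
Implicit Types s t : dnum R.

Definition dnum_zero : dnum R := DNum 0 0.
Definition dnum_one : dnum R := DNum 1 0.
Definition dnum_add s t := DNum (dre s + dre t) (dim s + dim t).
Definition dnum_opp t := DNum (- dre t) (- dim t).
Definition dnum_mul s t :=
  DNum (dre s * dre t + dim s * dim t) (dre s * dim t + dim s * dre t).

Lemma dnum_addA : associative dnum_add.
Proof. by move=> *; rewrite /dnum_add /= !addrA. Qed.
Lemma dnum_addC : commutative dnum_add.
Proof. by move=> s t; rewrite /dnum_add addrC [dim s + _]addrC. Qed.
Lemma dnum_add0 : left_id dnum_zero dnum_add.
Proof. by case=> a b; rewrite /dnum_add /= !add0r. Qed.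
Lemma dnum_addN : left_inverse dnum_zero dnum_opp dnum_add.
Proof. by case=> a b; rewrite /dnum_add /= !addNr. Qed.

HB.instance Definition _ := GRing.isZmodule.Build (dnum R)
  dnum_addA dnum_addC dnum_add0 dnum_addN.

Lemma dnum_mulA : associative dnum_mul.
Proof. by case=> a b [c d] [e f]; congr DNum => /=; ring. Qed.
Lemma dnum_mulC : commutative dnum_mul.
Proof. by case=> a b [c d]; congr DNum => /=; ring. Qed.
Lemma dnum_mul1 : left_id dnum_one dnum_mul.
Proof. by case=> a b; congr DNum => /=; ring. Qed.
Lemma dnum_mulDl : left_distributive dnum_mul +%R.
Proof. by case=> a b [c d] [e f]; congr DNum => /=; ring. Qed.
Lemma dnum_one_neq0 : dnum_one != 0.
Proof. by apply/eqP => -[] /eqP; rewrite oner_eq0. Qed.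

HB.instance Definition _ := GRing.Zmodule_isComNzRing.Build (dnum R)
  dnum_mulA dnum_mulC dnum_mul1 dnum_mulDl dnum_one_neq0.

Definition dnumC (r : R) : dnum R := DNum r 0.
Definition dnumj : dnum R := DNum 0 1.

(* [a + j b] for real vectors [a] and [b]. *)
Definition dvec n (a b : 'rV[R]_n) : 'rV[dnum R]_n :=
  map_mx dnumC a + dnumj *: map_mx dnumC b.

End DnumRing.

(** * The Minkowski product, over any commutative ring *)

(* Taken over [R] this is the product of [R^n_1]; over [dnum R] it is its
   [D]-bilinear extension.  The time-like coordinate is the first one. *)
Definition minkowski_mx (A : comNzRingType) (n : nat) : 'M[A]_n :=
  diag_mx (\row_(i < n) (if val i == 0%N then -1 else 1)).

Definition mdot (A : comNzRingType) (n : nat) (a b : 'rV[A]_n) : A :=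
  (a *m minkowski_mx A n *m b^T) 0 0.

Definition mnorm (R : realType) (n : nat) (a : 'rV[R]_n) : R :=
  Num.sqrt (mdot a a).

(** * Smooth maps on a plane domain *)

Section Plane.
Variable R : realType.

Definition eu : R * R := (1, 0).
Definition ev : R * R := (0, 1).

Definition domain (D : set (R * R)) := [/\ open D, connected D & D !=set0].

Definition du (V : normedModType R) (f : R * R -> V) : R * R -> V :=
  fun p => 'D_eu f p.
Definition dv (V : normedModType R) (f : R * R -> V) : R * R -> V :=
  fun p => 'D_ev f p.

(* [k] times differentiable on [D]; for open [D] and all [k] this is
   [C^infty]. *)
Fixpoint diff_upto (V : normedModType R) (k : nat) (D : set (R * R))
    (f : R * R -> V) : Prop :=
  if k is k'.+1 then
    [/\ forall p, D p -> differentiable f p,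
        diff_upto k' D (du f) & diff_upto k' D (dv f)]
  else True.

Definition smooth (V : normedModType R) (D : set (R * R)) (f : R * R -> V) :=
  forall k, diff_upto k D f.

(* Vector fields on the parameter domain and their Lie bracket. *)
Definition lie_bracket (X Y : R * R -> R * R) : R * R -> R * R :=
  fun p => 'D_(X p) Y p - 'D_(Y p) X p.

End Plane.

Arguments eu {R}.
Arguments ev {R}.

(** * Surfaces in [R^n_1] *)

(* A tangent vector field on the surface [x] is given by its coordinate field
   [X : R * R -> R * R] on the parameter domain; the corresponding field with
   values in [R^n_1] is [push x X].  A vector at a point [p] is given by its
   coordinates [w : R * R] and enters operations on fields as [cst w]; this is
   done only for the induced metric and [second_ff], which are tensorial, so the
   choice of the extending field is immaterial. *)
Section Surface.
Variables (R : realType) (n : nat) (x : R * R -> 'rV[R]_n).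
Implicit Types (X Y Z : R * R -> R * R) (N : R * R -> 'rV[R]_n) (p w : R * R).

Definition push X : R * R -> 'rV[R]_n := fun p => 'D_(X p) x p.

Definition induced_metric X Y p : R := mdot (push X p) (push Y p).

Definition metricE p : R := mdot (du x p) (du x p).
Definition metricF p : R := mdot (du x p) (dv x p).
Definition metricG p : R := mdot (dv x p) (dv x p).

Definition immersion_at p := injective ('d x p : R * R -> 'rV[R]_n).

Definition indefinite_at p :=
  (exists w, induced_metric (cst w) (cst w) p < 0) /\
  (exists w, 0 < induced_metric (cst w) (cst w) p).

(* [T_p(M)] and [N_p(M)] as row spaces of matrices; a vector [a] is orthogonal
   to [T_p(M)] iff [a *m minkowski_mx _ _ *m (tangent_space p)^T = 0]. *)
Definition tangent_space p : 'M[R]_n := (<<du x p>> + <<dv x p>>)%MS.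
Definition normal_space p : 'M[R]_n :=
  kermx (minkowski_mx R n *m (tangent_space p)^T).

(* Matrices (acting on row vectors) of the orthogonal projections. *)
Definition tangent_proj p : 'M[R]_n :=
  proj_mx (tangent_space p) (normal_space p).
Definition normal_proj p : 'M[R]_n :=
  proj_mx (normal_space p) (tangent_space p).

(* Flat connection of [R^n_1] along the surface, and its tangential part (on
   tangent fields, the Levi-Civita connection of the induced metric) and normal
   part. *)
Definition nabla X N : R * R -> 'rV[R]_n := fun p => 'D_(X p) N p.
Definition nablaT X N : R * R -> 'rV[R]_n :=
  fun p => nabla X N p *m tangent_proj p.
Definition nablaN X N : R * R -> 'rV[R]_n :=
  fun p => nabla X N p *m normal_proj p.

Definition second_ff X Y : R * R -> 'rV[R]_n :=
  fun p => nabla X (push Y) p *m normal_proj p.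

Definition curv_of
    (D : (R * R -> R * R) -> (R * R -> 'rV[R]_n) -> (R * R -> 'rV[R]_n))
    X Y N : R * R -> 'rV[R]_n :=
  fun p => D X (D Y N) p - D Y (D X N) p - D (lie_bracket X Y) N p.

Definition curvT X Y Z : R * R -> 'rV[R]_n := curv_of nablaT X Y (push Z).
Definition curvN X Y N : R * R -> 'rV[R]_n := curv_of nablaN X Y N.

Definition orthonormal_at X1 X2 p :=
  [/\ induced_metric X1 X1 p = -1, induced_metric X2 X2 p = 1 &
      induced_metric X1 X2 p = 0].

(* [H] and [K], for an orthonormal tangent frame [(X1, X2)]. *)
Definition mean_curvature X1 X2 p : 'rV[R]_n :=
  2^-1 *: (- second_ff X1 X1 p + second_ff X2 X2 p).
Definition gauss_curvature X1 X2 p : R :=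
  - mdot (curvT X1 X2 X2 p) (push X1 p).

Definition timelike_surface (D : set (R * R)) :=
  [/\ domain D, smooth D x, forall p, D p -> immersion_at p &
      forall p, D p -> indefinite_at p].

Definition minimal (D : set (R * R)) :=
  forall p w1 w2, D p -> orthonormal_at (cst w1) (cst w2) p ->
    mean_curvature (cst w1) (cst w2) p = 0.

Definition isothermal (D : set (R * R)) :=
  forall p, D p -> [/\ metricE p = - metricG p, metricF p = 0 & metricE p < 0].

(* [d/dt = 1/2 (d/du + j d/dv)] on [D^n]-valued maps, the partial derivatives
   being taken on the real and imaginary parts. *)
Definition ddt (f : R * R -> 'rV[dnum R]_n) : R * R -> 'rV[dnum R]_n :=
  let re q := map_mx (@dre R) (f q) in
  let im q := map_mx (@dim R) (f q) in
  fun p => dnumC 2^-1 *: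
    (dvec (du re p) (du im p) + dnumj R *: dvec (dv re p) (dv im p)).

Definition Phi : R * R -> 'rV[dnum R]_n := fun p => dvec (du x p) (dv x p).

(* The [D]-linear extension of the orthogonal projection to [N_p(M)]. *)
Definition dnormal_part p (a : 'rV[dnum R]_n) : 'rV[dnum R]_n :=
  a *m map_mx (@dnumC R) (normal_proj p).

Definition canonical_coordinates (D : set (R * R)) :=
  isothermal D /\
  forall p, D p ->
    let a := dnormal_part p (ddt Phi p) in mdot a a = 1.

End Surface.

(** * The hyperbola of the normal curvature *)

(* Hyperbola centred at [0] in the plane spanned by the orthonormal space-like
   vectors [hyp_e1], [hyp_e2]: the points [s hyp_e1 + t hyp_e2] with
   [s^2 / hyp_a^2 - t^2 / hyp_b^2 = 1]. *)
Record hyperbola (R : realType) (n : nat) := Hyperbola {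
  hyp_e1 : 'rV[R]_n;
  hyp_e2 : 'rV[R]_n;
  hyp_a : R;
  hyp_b : R;
  hyp_orthonormal :
    [/\ mdot hyp_e1 hyp_e1 = 1, mdot hyp_e2 hyp_e2 = 1 &
        mdot hyp_e1 hyp_e2 = 0];
  hyp_semiaxes_gt0 : 0 < hyp_a /\ 0 < hyp_b
}.

Section Hyperbola.
Variables (R : realType) (n : nat).
Implicit Types (h : hyperbola R n).

(* The two branches: [0 < s] for [neg = false], [s < 0] for [neg = true]. *)
Definition branch h (neg : bool) : set 'rV[R]_n :=
  [set a | exists s t, [/\ a = s *: hyp_e1 h + t *: hyp_e2 h,
     s ^+ 2 / hyp_a h ^+ 2 - t ^+ 2 / hyp_b h ^+ 2 = 1 & 0 < (-1) ^+ neg * s]].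

Definition real_axis h : set 'rV[R]_n := [set a | exists c, a = c *: hyp_e1 h].
Definition conjugate_axis h : set 'rV[R]_n :=
  [set a | exists c, a = c *: hyp_e2 h].
Definition real_semiaxis h : R := hyp_a h.
Definition conjugate_semiaxis h : R := hyp_b h.

Definition normal_curvature_set (x : R * R -> 'rV[R]_n) (p : R * R) :
    set 'rV[R]_n :=
  [set second_ff x (cst w) (cst w) p |
    w in [set w | induced_metric x (cst w) (cst w) p = 1]].

(* [h] is the hyperbola having the normal curvature set as a branch.  A branch
   spans its plane, so the plane of [h] is the one spanned by
   [sigma(X1,X1)] and [sigma(X1,X2)]. *)
Definition normal_curvature_hyperbola (x : R * R -> 'rV[R]_n) (p : R * R) h :=
  exists neg, normal_curvature_set x p = branch h neg.

End Hyperbola.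

(* Main.v *)
Require Import Defs.
From HB Require Import structures.
From mathcomp Require Import all_boot all_order all_algebra ring lra.
From mathcomp Require Import all_classical all_reals all_analysis.

(** On a minimal surface in isothermal coordinates, with k = -1/E, the frame
    satisfies sigma(X1,X1) = sigma(X2,X2) = k A and sigma(X1,X2) = k B, where A
    and B are the normal parts of x_uu and x_uv.  Since the normal part of Phi'
    is A + j B, canonicity says A.A + B.B = 1 and A.B = 0, hence n1 and n2 are
    orthogonal and nu^2 + mu^2 = k^2.  As the flat connection has no curvature,
    the tangential and normal curvatures are products of second fundamental
    forms (Gauss and Ricci equations): K = mu^2 - nu^2 and kappa = 2 nu mu, so
    K^2 + kappa^2 = (nu^2 + mu^2)^2.  The axes of the hyperbola are recovered
    from the branch alone, because its vertex is its point nearest to 0. *)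

Set Implicit Arguments.
Unset Strict Implicit.
Unset Printing Implicit Defensive.

Import Order.TTheory GRing.Theory Num.Theory.
Import numFieldNormedType.Exports.

Local Open Scope classical_set_scope.
Local Open Scope ring_scope.

(** * Symmetry of second derivatives *)

(** Two obstacles shape the proof. The projections are given pointwise by [proj_mx], with no visible
    dependence on the point, whereas the curvatures differentiate projected fields; since x_u and
    x_v are orthogonal with squares E and -E, an explicit formula replaces [proj_mx] and makes the
    projected fields smooth. Moreover sigma(X1,X1) and sigma(X1,X2) are known to be nonzero at p
    only, whereas kappa differentiates n1 and n2 around p; so it is computed on an open set where
    both have positive square. Gauss and Ricci are two readings of one computation. For
    complementary projections P and C and a field V orthogonal to the image of C, the function (C
    W).V is zero, and its product rule trades a second derivative of the projected field for a
    product of first-order terms. Equality of mixed partial derivatives underlies both the flatness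
    of [nabla] and the symmetry of sigma. The orthonormal frame is a rescaled coordinate frame,
    whose fields need not commute, so the bracket terms have to be kept. *)

Section Schwarz.
Variables (R : realType) (V : normedModType R).
Implicit Types (f : V -> R) (p q a b v : V).

Lemma is_derive_line f q v (s : R) : differentiable f (q + s *: v) ->
  is_derive s 1 (fun s => f (q + s *: v)) ('D_v f (q + s *: v)).
Proof.
move=> df; pose l (s : R) := q + s *: v.
have dl : is_diff s l (fun h => h *: v).
  by apply: is_diff_eq; apply/funext => h; rewrite !fctE add0r.
have dfl : differentiable (f \o l) s by exact: differentiable_comp.
apply: DeriveDef; first exact: diff_derivable.
rewrite deriveE // (_ : (fun s => f _) = f \o l) // diff_comp //.
by rewrite /= diff_val scale1r -deriveE.
Qed.

Lemma mvt_line f q v (h : R) : 0 < h ->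
  (forall s, 0 <= s <= h -> differentiable f (q + s *: v)) ->
  exists2 s, 0 < s < h & f (q + h *: v) - f q = h * 'D_v f (q + s *: v).
Proof.
move=> h0 df.
have [||s sh E] := @MVT R (fun s => f (q + s *: v))
    (fun s => 'D_v f (q + s *: v)) 0 h h0.
- move=> s /[!in_itv]/= /andP[s0 sh]; apply: is_derive_line.
  by apply: df; rewrite !ltW.
- apply: continuous_in_subspaceT => s /[!inE] /= /[!in_itv] /= sh.
  by have [/derivable1_diffP /differentiable_continuous] := is_derive_line (df s sh).
exists s; first by move: sh; rewrite in_itv.
by move: E; rewrite scale0r addr0 subr0 mulrC.
Qed.

Lemma derive_translate f c v q :
  'D_v (fun z => f (z + c)) q = 'D_v f (q + c).
Proof.
rewrite /derive; set F := (X in lim (X @ _)); set G := (X in _ = lim (X @ _)).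
suff -> : F = G by [].
by apply/funext => h; rewrite /F /G /= addrA.
Qed.

(** The second difference is the increment along [a] of z -> f (z + h b) - f z. A mean value in
    direction [a] produces an increment of 'D_a f along [b], and a second mean value finishes. *)
Lemma second_difference f p a b (h : R) : 0 < h ->
  (forall s t, 0 <= s <= h -> 0 <= t <= h ->
     differentiable f (p + s *: a + t *: b) /\
     differentiable ('D_a f) (p + s *: a + t *: b)) ->
  exists s t, [/\ 0 < s < h, 0 < t < h &
    f (p + h *: a + h *: b) - f (p + h *: a) - f (p + h *: b) + f p =
    h ^+ 2 * 'D_b ('D_a f) (p + s *: a + t *: b)].
Proof.
move=> h0 df; have hh : 0 <= h <= h by apply/andP; split=> //; exact: ltW.
have h00 : (0 : R) <= 0 <= h by apply/andP; split=> //; exact: ltW.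
pose g z := f (z + h *: b) - f z.
have dfh s : 0 <= s <= h -> differentiable (fun z => f (z + h *: b)) (p + s *: a).
  move=> sh; apply: (@differentiable_comp _ _ _ _ (fun z => z + h *: b) f).
    exact: differentiableD.
  exact: (df s h sh hh).1.
have df0 s : 0 <= s <= h -> differentiable f (p + s *: a).
  by move=> sh; have [] := df s 0 sh h00; rewrite scale0r addr0.
have [|s sh Es] := @mvt_line g p a h h0.
  by move=> s sh; apply: differentiableB; auto.
have sh' : 0 <= s <= h by case/andP: sh => ? ?; rewrite !ltW.
have [|t th Et] := @mvt_line ('D_a f) (p + s *: a) b h h0.
  by move=> t th; exact: (df s t sh' th).2.
exists s, t; split=> //.
transitivity (g (p + h *: a) - g p); first by rewrite /g; ring.
rewrite Es deriveB; try by apply: diff_derivable; auto.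
by rewrite derive_translate Et; ring.
Qed.

(** The second difference is symmetric in [a] and [b], so for every small h the two mixed
    derivatives take a common value, at two possibly different points of a small parallelogram.
    Continuity at p carries the equality to p. *)
Theorem derive_comm f p a b :
  (\near p, differentiable f p) ->
  (\near p, differentiable ('D_a f) p) ->
  (\near p, differentiable ('D_b f) p) ->
  {for p, continuous ('D_b ('D_a f))} -> {for p, continuous ('D_a ('D_b f))} ->
  'D_b ('D_a f) p = 'D_a ('D_b f) p.
Proof.
move=> df da db cba cab; apply/eqP; rewrite -subr_eq0 -normr_eq0.
rewrite eq_le normr_ge0 andbT; apply/ler_addgt0Pr => e e0; rewrite add0r.
have e20 : 0 < e / 2 by rewrite divr_gt0.
move/cvgrPdist_lt : cba => /(_ _ e20) nba.
move/cvgrPdist_lt : cab => /(_ _ e20) nab.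
pose P q := [/\ differentiable f q, differentiable ('D_a f) q,
  differentiable ('D_b f) q, `|'D_b ('D_a f) p - 'D_b ('D_a f) q| < e / 2 &
  `|'D_a ('D_b f) p - 'D_a ('D_b f) q| < e / 2].
have nP : nbhs p P.
  apply: filterS (filterI (filterI (filterI (filterI df da) db) nba) nab).
  by move=> q [[[[H1 H2] H3] H4] H5]; exact (And5 H1 H2 H3 H4 H5).
move: nP => /nbhs_ballP[r /= r0 Hr].
have [h h0 near_p] : exists2 h : R, 0 < h & forall s t : R,
    0 <= s <= h -> 0 <= t <= h -> P (p + s *: a + t *: b).
  have c0 : 0 < `|a| + `|b| + 1 by rewrite ltr_wpDl // addr_ge0.
  (* The summand 1 keeps the divisor positive when [a] and [b] both vanish, and r / 2 makes the
     final bound strict. *)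
  exists (r / 2 / (`|a| + `|b| + 1)); first by rewrite !divr_gt0.
  set h := _ / _; move=> s t /andP[s0 sh] /andP[t0 th].
  apply: Hr; rewrite -ball_normE /=.
  rewrite opprD addrA opprD addrA subrr add0r -opprD normrN.
  have N : `|s *: a + t *: b| <= h * (`|a| + `|b|).
    apply: le_trans (ler_normD _ _) _; rewrite !normrZ !ger0_norm // mulrDr.
    by apply: lerD; apply: ler_wpM2r.
  apply: le_lt_trans N _; apply: (@le_lt_trans _ _ (r / 2)); last by lra.
  rewrite /h mulrAC ler_pdivrMr // ler_wpM2l ?ltW ?divr_gt0 //.
  by rewrite ltrDl.
have [s t sh th|s [t [sh th Eba]]] := @second_difference f p a b h h0.
  by case: (near_p s t sh th) => d1 d2 _ _ _; exact: (conj d1 d2).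
have [s' t' sh' th'|s' [t' [sh' th' Eab]]] := @second_difference f p b a h h0.
  rewrite addrAC.
  by case: (near_p t' s' th' sh') => d1 _ d2 _ _; exact: (conj d1 d2).
rewrite [p + s' *: b + _]addrAC in Eab.
have E : 'D_b ('D_a f) (p + s *: a + t *: b) =
         'D_a ('D_b f) (p + t' *: a + s' *: b).
  have h2 : h ^+ 2 != 0 by rewrite expf_neq0 // gt_eqF.
  rewrite [p + h *: b + _]addrAC in Eab.
  apply: (mulfI h2); apply: etrans (esym Eba) _; apply: etrans _ Eab.
  ring.
have lew (x y : R) : 0 < x < y -> 0 <= x <= y by case/andP => ? ?; rewrite !ltW.
have [_ _ _ + _] := near_p _ _ (lew _ _ sh) (lew _ _ th).
have [_ _ _ _ +] := near_p _ _ (lew _ _ th') (lew _ _ sh').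
rewrite E; move: ('D_a ('D_b f) p) ('D_b ('D_a f) p)
  ('D_a ('D_b f) (p + t' *: a + s' *: b)) => A B C.
rewrite distrC => H1 H2; apply: ltW; rewrite [e]splitr -(subrKA C).
by apply: le_lt_trans (ler_normD _ _) _; rewrite ltrD.
Qed.

End Schwarz.

(** * Closure properties of smooth maps *)

(** The difference g - f vanishes near [a], so it has differential zero there; adding it to f gives
    g. *)
Lemma near_eq_differentiable (R : numFieldType) (V W : normedModType R)
    (f g : V -> W) (a : V) :
  (\near a, f a = g a) -> differentiable f a -> differentiable g a.
Proof.
move=> fg df; rewrite -(subrK f g); apply: differentiableD => //.
have gf0 : (g - f) \o shift a = cst ((g - f) a) + (\0 : {linear V -> W}) +o_ 0 id.
  apply/eqaddoP => e e0.
  have fga : f a = g a by exact: nbhs_singleton fg.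
  have : \forall z \near (0 : V), f (z + a) = g (z + a).
    by move: fg; rewrite (near_shift 0) /= subr0.
  apply: filterS => z fgz.
  rewrite [X in `|X|](_ : _ = 0) ?normr0 ?mulr_ge0 ?(ltW e0) //.
  by rewrite !fctE /= fgz fga !subrr addr0 subrr.
have d0 : 'd (g - f) a = \0 :> (V -> W).
  by apply: diff_unique gf0 => y; exact: cst_continuous.
apply/diff_locallyP; rewrite d0; split => // y; exact: cst_continuous.
Qed.

Section SmoothClosure.
Variables (R : realType) (D : set (R * R)).
Hypothesis openD : open D.

Lemma open_nearP (V : Type) (f g : R * R -> V) p :
  (forall q, D q -> f q = g q) -> D p -> \near p, f p = g p.
Proof.
by move=> fg Dp; apply: filterS fg _; apply: open_nbhs_nbhs.
Qed.

Lemma diff_upto_ext (V : normedModType R) k (f g : R * R -> V) :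
  (forall q, D q -> f q = g q) -> diff_upto k D f -> diff_upto k D g.
Proof.
elim: k f g => //= k IH f g fg [df fu fv]; split.
- move=> p Dp; apply: near_eq_differentiable (df p Dp); exact: open_nearP.
- by apply: IH fu => q Dq; apply: near_eq_derive; exact: open_nearP.
- by apply: IH fv => q Dq; apply: near_eq_derive; exact: open_nearP.
Qed.

Lemma diff_uptoW (V : normedModType R) k (f : R * R -> V) :
  diff_upto k.+1 D f -> diff_upto k D f.
Proof.
elim: k f => //= k IH f [df fu fv]; split=> //; exact: IH.
Qed.

Lemma diff_uptoD (V : normedModType R) k (f g : R * R -> V) :
  diff_upto k D f -> diff_upto k D g -> diff_upto k D (fun q => f q + g q).
Proof.
elim: k f g => //= k IH f g [df fu fv] [dg gu gv]; split.
- by move=> p Dp; apply: differentiableD; auto.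
- apply: diff_upto_ext (IH _ _ fu gu) => q Dq.
  by rewrite /du deriveD //; apply: diff_derivable; auto.
- apply: diff_upto_ext (IH _ _ fv gv) => q Dq.
  by rewrite /dv deriveD //; apply: diff_derivable; auto.
Qed.

Lemma diff_upto_cst (V : normedModType R) k (a : V) :
  diff_upto k D (fun _ => a).
Proof.
elim: k a => //= k IH a; split.
- by move=> p _; exact: differentiable_cst.
- by apply: diff_upto_ext (IH 0) => q _; rewrite /du derive_cst.
- by apply: diff_upto_ext (IH 0) => q _; rewrite /dv derive_cst.
Qed.

(** The product rule as a property of a bare binary operation, so that scaling, multiplication and
    the Minkowski product share one induction on the order of differentiability. *)
Definition leibniz (U V W : normedModType R) (op : U -> V -> W) :=
  forall (f : R * R -> U) (g : R * R -> V) p,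
    differentiable f p -> differentiable g p ->
    differentiable (fun q => op (f q) (g q)) p /\
    forall v, 'D_v (fun q => op (f q) (g q)) p =
      op ('D_v f p) (g p) + op (f p) ('D_v g p).

Lemma diff_upto_leibniz (U V W : normedModType R) (op : U -> V -> W) :
  leibniz op -> forall k f g, diff_upto k D f -> diff_upto k D g ->
  diff_upto k D (fun q => op (f q) (g q)).
Proof.
move=> lop; elim=> // k IH f g Hf Hg.
have [fk gk] := (diff_uptoW Hf, diff_uptoW Hg).
case: Hf Hg => [df fu fv] [dg gu gv]; split.
- by move=> p Dp; apply: (lop _ _ _ _ _).1; auto.
- apply: diff_upto_ext (diff_uptoD (IH _ _ fu gk) (IH _ _ fk gu)) => q Dq.
  by rewrite /du (lop _ _ _ _ _).2; auto.
- apply: diff_upto_ext (diff_uptoD (IH _ _ fv gk) (IH _ _ fk gv)) => q Dq.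
  by rewrite /dv (lop _ _ _ _ _).2; auto.
Qed.

Lemma leibniz_bilin (U V W : normedModType R) (op : {bilinear U -> V -> W}) :
  continuous (fun p => op p.1 p.2) -> leibniz op.
Proof.
move=> cop f g p df dg.
pose h q := (f q, g q).
have dh : differentiable h p by exact: differentiable_pair.
have dop : differentiable (fun z : U * V => op z.1 z.2) (h p).
  exact: differentiable_bilin.
have -> : (fun q => op (f q) (g q)) = (fun z : U * V => op z.1 z.2) \o h by [].
split; first exact: differentiable_comp.
move=> v; rewrite deriveE; last exact: differentiable_comp.
by rewrite diff_comp //= diff_bilin //= diff_pair //= -!deriveE // addrC.
Qed.

End SmoothClosure.

(** * Product rules for scaling, multiplication and the Minkowski product *)

Lemma scaler_is_bilinear (R : realType) (V : normedModType R) :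
  bilinear_for
    (GRing.Scale.Law.clone _ _ *:%R _) (GRing.Scale.Law.clone _ _ *:%R _)
    (@GRing.scale R V : R -> V -> V).
Proof.
split=> [u'|u] a x y /=; first by rewrite scalerDl scalerA.
by rewrite scalerDr !scalerA mulrC.
Qed.

HB.instance Definition _ (R : realType) (V : normedModType R) :=
  bilinear_isBilinear.Build R R V V _ _ (@GRing.scale R V : R -> V -> V)
    (scaler_is_bilinear V).

Lemma leibniz_scale (R : realType) (V : normedModType R) :
  leibniz (@GRing.scale R V : R -> V -> V).
Proof. by apply: leibniz_bilin; exact: scale_continuous. Qed.

Lemma leibniz_mul (R : realType) : leibniz (@GRing.mul R : R -> R -> R).
Proof. by apply: leibniz_bilin; exact: mul_continuous. Qed.

Lemma mdotE (A : comNzRingType) n (a b : 'rV[A]_n) :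
  mdot a b = \sum_(i < n) (if val i == 0%N then -1 else 1) * (a 0 i * b 0 i).
Proof.
rewrite /mdot mxE; apply: eq_bigr => i _.
rewrite /minkowski_mx mul_mx_diag !mxE mulrCA mulrA; ring.
Qed.

Lemma mdotC (A : comNzRingType) n (a b : 'rV[A]_n) : mdot a b = mdot b a.
Proof. by rewrite !mdotE; apply: eq_bigr => i _; rewrite [a _ _ * _]mulrC. Qed.

Lemma mdot_is_bilinear (R : comNzRingType) n :
  bilinear_for
    (GRing.Scale.Law.clone _ _ *:%R _) (GRing.Scale.Law.clone _ _ *:%R _)
    (@mdot R n : 'rV_n -> 'rV_n -> R^o).
Proof.
suff lin u : linear (mdot u : 'rV_n -> R^o).
  by split=> // u' a x y /=; rewrite mdotC (mdotC x) (mdotC y); exact: lin.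
by move=> a x y; rewrite /mdot linearP /= mulmxDr -scalemxAr !mxE.
Qed.

HB.instance Definition _ (R : comNzRingType) n :=
  bilinear_isBilinear.Build R 'rV[R]_n 'rV[R]_n R^o _ _
  (@mdot R n : 'rV_n -> 'rV_n -> R^o) (@mdot_is_bilinear R n).

Lemma leibniz_mdot (R : realType) n :
  leibniz (@mdot R n : 'rV[R]_n -> 'rV[R]_n -> R).
Proof.
apply: leibniz_bilin => /=.
rewrite (_ : (fun _ => _) = fun p : 'rV[R]_n * 'rV[R]_n =>
  \sum_(i < n) (if val i == 0%N then -1 else 1) * (p.1 0 i * p.2 0 i)).
  rewrite -fct_sumE; elim/big_ind: _ => [|f g cf cg|i _] //.
  - exact: cst_continuous.
  - by move=> q; apply: cvgD; [exact: cf | exact: cg].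
  move=> q; apply: cvgM; first exact: cvg_cst.
  apply: cvgM.
    apply: (@continuous_comp _ _ _ fst (fun M : 'rV_n => M 0 i)).
      exact: cvg_fst.
    exact: coord_continuous.
  apply: (@continuous_comp _ _ _ snd (fun M : 'rV_n => M 0 i)).
    exact: cvg_snd.
  exact: coord_continuous.
by apply/funext => q; rewrite mdotE.
Qed.

(** * Algebra of smooth maps; mixed partial derivatives of vector-valued maps *)

Section Smooth.
Variables (R : realType) (D : set (R * R)).
Hypothesis openD : open D.

Lemma smooth_ext (V : normedModType R) (f g : R * R -> V) :
  (forall q, D q -> f q = g q) -> smooth D f -> smooth D g.
Proof. by move=> fg sf k; apply: diff_upto_ext fg (sf k). Qed.

Lemma smooth_differentiable (V : normedModType R) (f : R * R -> V) p :
  smooth D f -> D p -> differentiable f p.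
Proof. by move=> /(_ 1)[df _ _] /df. Qed.

Lemma smooth_derivable (V : normedModType R) (f : R * R -> V) p v :
  smooth D f -> D p -> derivable f p v.
Proof. by move=> sf Dp; apply/diff_derivable/smooth_differentiable. Qed.

Lemma smooth_du (V : normedModType R) (f : R * R -> V) :
  smooth D f -> smooth D (du f).
Proof. by move=> sf k; case: (sf k.+1). Qed.

Lemma smooth_dv (V : normedModType R) (f : R * R -> V) :
  smooth D f -> smooth D (dv f).
Proof. by move=> sf k; case: (sf k.+1). Qed.

Lemma smooth_cst (V : normedModType R) (a : V) : smooth D (fun _ => a).
Proof. by move=> k; exact: diff_upto_cst. Qed.

Lemma smoothD (V : normedModType R) (f g : R * R -> V) :
  smooth D f -> smooth D g -> smooth D (fun q => f q + g q).
Proof. by move=> sf sg k; exact: diff_uptoD. Qed.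

Lemma smoothZ (V : normedModType R) (c : R * R -> R) (f : R * R -> V) :
  smooth D c -> smooth D f -> smooth D (fun q => c q *: f q).
Proof.
by move=> sc sf k; apply: diff_upto_leibniz => //; exact: leibniz_scale.
Qed.

Lemma smoothM (f g : R * R -> R) :
  smooth D f -> smooth D g -> smooth D (fun q => f q * g q).
Proof. by move=> sf sg; exact: smoothZ. Qed.

Lemma smoothN (V : normedModType R) (f : R * R -> V) :
  smooth D f -> smooth D (fun q => - f q).
Proof.
move=> sf; apply: (@smooth_ext _ (fun q => -1 *: f q)).
  by move=> q _; rewrite scaleN1r.
by apply: (@smoothZ _ (fun=> -1)) => //; exact: smooth_cst.
Qed.

Lemma smoothB (V : normedModType R) (f g : R * R -> V) :
  smooth D f -> smooth D g -> smooth D (fun q => f q - g q).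
Proof. by move=> sf sg; apply: smoothD => //; exact: smoothN. Qed.

Lemma smooth_mdot n (f g : R * R -> 'rV[R]_n) :
  smooth D f -> smooth D g -> smooth D (fun q => mdot (f q) (g q)).
Proof.
by move=> sf sg k; apply: diff_upto_leibniz => //; exact: leibniz_mdot.
Qed.

(** Induction on the order: the derivative of 1/f is the product of -f' with two copies of 1/f,
    which the induction hypothesis covers. *)
Lemma smoothV (f : R * R -> R) :
  (forall q, D q -> f q != 0) -> smooth D f -> smooth D (fun q => (f q)^-1).
Proof.
move=> f0 sf; elim=> // k IH; split.
- by move=> p Dp; apply: differentiableV (f0 p Dp); exact: smooth_differentiable.
- apply: diff_upto_ext (diff_upto_leibniz openD (@leibniz_mul R)
    (diff_upto_leibniz openD (@leibniz_mul R) IH IH)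
    (smoothN (smooth_du sf) k)) => // q Dq.
  rewrite /du deriveV ?f0 //; last exact: smooth_derivable.
  by rewrite -exprVn expr2 /GRing.scale /= mulrN mulNr.
- apply: diff_upto_ext (diff_upto_leibniz openD (@leibniz_mul R)
    (diff_upto_leibniz openD (@leibniz_mul R) IH IH)
    (smoothN (smooth_dv sf) k)) => // q Dq.
  rewrite /dv deriveV ?f0 //; last exact: smooth_derivable.
  by rewrite -exprVn expr2 /GRing.scale /= mulrN mulNr.
Qed.

Lemma is_derive_comp_real (V : normedModType R) (f : V -> R) (g : R -> R) p v dg :
  differentiable f p -> is_derive (f p) 1 g dg ->
  differentiable (g \o f) p /\ 'D_v (g \o f) p = 'D_v f p * dg.
Proof.
move=> df [/derivable1_diffP Dg <-]; split; first exact: differentiable_comp.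
rewrite deriveE; last exact: differentiable_comp.
rewrite diff_comp //= !deriveE // -[X in 'd g _ X]mulr1.
by rewrite -[_ * 1]/('d f p v *: (1 : R)) linearZ.
Qed.

(** The derivative contains 1 / (2 sqrt f), which equals sqrt f times 1 / (2 f). So the induction
    hypothesis on sqrt f and the smoothness of the inverse of 2 f suffice. *)
Lemma smooth_sqrt (f : R * R -> R) :
  (forall q, D q -> 0 < f q) -> smooth D f ->
  smooth D (fun q => Num.sqrt (f q)).
Proof.
move=> f0 sf.
have main v q (Dq : D q) :=
  is_derive_comp_real v (smooth_differentiable sf Dq) (is_derive1_sqrt (f0 q Dq)).
have eqd v q : D q -> 'D_v (fun q => Num.sqrt (f q)) q =
    'D_v f q * (2 * Num.sqrt (f q))^-1 by case/(main v).
elim=> // k IH.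
have IHV : diff_upto k D (fun q => (2 * Num.sqrt (f q))^-1).
  apply: (@diff_upto_ext _ _ _ _ _ (fun q => Num.sqrt (f q) * (2 * f q)^-1)).
  - exact: openD.
  - move=> q Dq; rewrite -[X in 2 * X](sqr_sqrtr (ltW (f0 q Dq))) expr2.
    have s0 : Num.sqrt (f q) != 0 by rewrite sqrtr_eq0 -ltNge f0.
    by field.
  apply: (diff_upto_leibniz openD (@leibniz_mul R)) => //.
  apply: smoothV; last by apply: smoothM => //; exact: smooth_cst.
  by move=> q Dq; rewrite mulf_neq0 // gt_eqF ?f0.
split; first by move=> p /(main eu)[].
- apply: diff_upto_ext (diff_upto_leibniz openD (@leibniz_mul R)
    (smooth_du sf k) IHV) => // q Dq.
  by rewrite /du eqd.
- apply: diff_upto_ext (diff_upto_leibniz openD (@leibniz_mul R)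
    (smooth_dv sf k) IHV) => // q Dq.
  by rewrite /dv eqd.
Qed.

Lemma derive_coord n (f : R * R -> 'rV[R]_n) i p v :
  derivable f p v -> 'D_v (fun q => f q 0 i) p = 'D_v f p 0 i.
Proof. by move=> df; rewrite derive_mx // mxE. Qed.

Lemma smooth_coord n (f : R * R -> 'rV[R]_n) i :
  smooth D f -> smooth D (fun q => f q 0 i).
Proof.
move=> sf k; elim: k f sf => // k IH f sf; split.
- move=> p Dp; apply: (@differentiable_comp _ _ _ _ f (fun M : 'rV_n => M 0 i)).
    exact: smooth_differentiable.
  exact: differentiable_coord.
- apply: diff_upto_ext (IH _ (smooth_du sf)) => // q Dq.
  by rewrite /du derive_coord //; exact: smooth_derivable.
- apply: diff_upto_ext (IH _ (smooth_dv sf)) => // q Dq.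
  by rewrite /dv derive_coord //; exact: smooth_derivable.
Qed.

(** The mean value theorem behind [derive_comm] is scalar, hence the passage to coordinates. *)
Lemma smooth_dudv n (f : R * R -> 'rV[R]_n) p :
  smooth D f -> D p -> du (dv f) p = dv (du f) p.
Proof.
move=> sf Dp; apply/rowP => i.
have nearD (P : R * R -> Prop) : (forall q, D q -> P q) -> \near p, P p.
  by move=> DP; apply: filterS DP _; exact: open_nbhs_nbhs.
have sfi := smooth_coord i sf.
have diff (g : R * R -> R) : smooth D g -> \near p, differentiable g p.
  by move=> sg; apply: nearD => q Dq; exact: smooth_differentiable Dq.
have ct (g : R * R -> R) : smooth D g -> {for p, continuous g}.
  by move=> sg; apply/differentiable_continuous; exact: smooth_differentiable Dp.
have := derive_comm (diff _ sfi) (diff _ (smooth_dv sfi)) (diff _ (smooth_du sfi))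
   (ct _ (smooth_du (smooth_dv sfi))) (ct _ (smooth_dv (smooth_du sfi))).
have E (g : R * R -> 'rV[R]_n) v w : smooth D g -> smooth D ('D_w g) ->
    'D_v ('D_w (fun q => g q 0 i)) p = 'D_v ('D_w g) p 0 i.
  move=> sg swg; rewrite -(derive_coord i (smooth_derivable swg Dp)).
  apply: near_eq_derive; apply: nearD => q Dq.
  by rewrite (derive_coord i (smooth_derivable sg Dq)).
move=> C; exact: etrans (esym (E f eu ev sf (smooth_dv sf)))
  (etrans C (E f ev eu sf (smooth_du sf))).
Qed.

End Smooth.

(** * Minkowski space and orthogonal projections *)

Section MdotAlgebra.
Variables (A : comNzRingType) (n : nat).
Implicit Types a b c : 'rV[A]_n.

Lemma mdotDr a b c : mdot a (b + c) = mdot a b + mdot a c.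
Proof. exact: (linearDr (@mdot A n : 'rV_n -> 'rV_n -> A^o)). Qed.
Lemma mdotZr (k : A) a b : mdot a (k *: b) = k * mdot a b.
Proof. exact: (linearZr_LR (@mdot A n : 'rV_n -> 'rV_n -> A^o)). Qed.
Lemma mdotDl a b c : mdot (b + c) a = mdot b a + mdot c a.
Proof. by rewrite mdotC mdotDr !(mdotC a). Qed.
Lemma mdotZl (k : A) a b : mdot (k *: b) a = k * mdot b a.
Proof. by rewrite mdotC mdotZr (mdotC a). Qed.
Lemma mdotNr a b : mdot a (- b) = - mdot a b.
Proof. by rewrite -scaleN1r mdotZr mulN1r. Qed.
Lemma mdotNl a b : mdot (- b) a = - mdot b a.
Proof. by rewrite mdotC mdotNr mdotC. Qed.
Lemma mdot0r a : mdot a 0 = 0.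
Proof. by rewrite -(scale0r 0) mdotZr mul0r. Qed.
Lemma mdot0l a : mdot 0 a = 0.
Proof. by rewrite mdotC mdot0r. Qed.

Definition mdot_lin := (mdotDl, mdotDr, mdotZl, mdotZr, mdotNl, mdotNr).

End MdotAlgebra.

Section Minkowski.
Variables (R : realType) (n : nat).
Implicit Types a b t : 'rV[R]_n.

Lemma mdot_spacelike_ge0 a :
  (forall i, val i = 0%N -> a 0 i = 0) -> 0 <= mdot a a ?= iff (a == 0).
Proof.
move=> a0.
have E : mdot a a = \sum_(i < n) a 0 i ^+ 2.
  rewrite mdotE; apply: eq_bigr => i _; rewrite -expr2.
  case: eqP => [/a0 ->|_]; last by rewrite mul1r.
  by rewrite expr0n mulr0.
apply/leifP; have [->|] := eqVneq a 0; first by rewrite mdot0l.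
move=> an0; rewrite lt_neqAle E sumr_ge0 ?andbT => [|i _]; last exact: sqr_ge0.
rewrite eq_sym psumr_eq0 => [|i _]; last exact: sqr_ge0.
apply: contra an0 => /allP s0; apply/eqP/rowP => i; apply/eqP.
by have := s0 i (mem_index_enum _); rewrite sqrf_eq0 mxE.
Qed.

(* The combination below has no time component, so it lies in a Euclidean subspace. *)
Lemma timelike_orthogonal_gt0 t a :
  mdot t t < 0 -> mdot a t = 0 -> a != 0 -> 0 < mdot a a.
Proof.
move=> t_time at0 a0.
have [i0 i00 ti0] : exists2 i, val i = 0%N & t 0 i != 0.
  apply: contrapT => nt; move: t_time; rewrite ltNge mdot_spacelike_ge0 // => i vi.
  by apply/eqP/negPn/negP => ti; apply: nt; exists i.
pose b := t 0 i0 *: a - a 0 i0 *: t.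
have /mdot_spacelike_ge0 bb : forall i, val i = 0%N -> b 0 i = 0.
  move=> i vi; have -> : i = i0 by apply: val_inj; rewrite vi.
  by rewrite !mxE mulrC subrr.
have bE : mdot b b = t 0 i0 ^+ 2 * mdot a a + a 0 i0 ^+ 2 * mdot t t.
  by rewrite !mdot_lin (mdotC t) at0; ring.
have t2 : 0 < t 0 i0 ^+ 2 by rewrite exprn_even_gt0.
rewrite -(pmulr_rgt0 _ t2).
have -> : t 0 i0 ^+ 2 * mdot a a = mdot b b - a 0 i0 ^+ 2 * mdot t t.
  by rewrite bE addrK.
(* Strictness has two sources: if the time component of [a] is zero, then [b] is a nonzero multiple
   of [a]; otherwise the subtracted term is negative. *)
have [ai0|ai0] := eqVneq (a 0 i0) 0.
  rewrite ai0 expr0n mul0r subr0 lt_neqAle !bb andbT.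
  by rewrite /b ai0 scale0r subr0 scaler_eq0 negb_or ti0.
rewrite subr_gt0 (@lt_le_trans _ _ 0) ?bb // pmulr_rlt0 //.
by rewrite exprn_even_gt0.
Qed.

End Minkowski.

Lemma minkowski_sym (A : comNzRingType) n :
  (minkowski_mx A n)^T = minkowski_mx A n.
Proof. exact: tr_diag_mx. Qed.

(** * Orthogonal projections for a plane with orthogonal basis of squares E and -E *)

Section Projection.
Variables (R : realType) (n : nat) (e f : 'rV[R]_n) (E : R).
Hypothesis ee : mdot e e = E.
Hypothesis ff : mdot f f = - E.
Hypothesis ef : mdot e f = 0.
Hypothesis E0 : E < 0.
Local Notation tangent := (<<e>> + <<f>>)%MS.
Local Notation normal := (kermx (minkowski_mx R n *m tangent^T)).
Implicit Types a b w : 'rV[R]_n.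

Let fe : mdot f e = 0. Proof. by rewrite mdotC. Qed.

Lemma span2P w : reflect (exists k l, w = k *: e + l *: f) (w <= tangent)%MS.
Proof.
apply: (iffP idP) => [/sub_addsmxP[[u v] /= ->]|[k [l ->]]].
  have /sub_rVP[k ->] : (u *m <<e>>%MS <= e)%MS by rewrite -(genmxE e) submxMl.
  have /sub_rVP[l ->] : (v *m <<f>>%MS <= f)%MS by rewrite -(genmxE f) submxMl.
  by exists k, l.
by apply: addmx_sub_adds; rewrite genmxE scalemx_sub.
Qed.

Lemma span2_orthP w :
  reflect (mdot w e = 0 /\ mdot w f = 0) (w <= normal)%MS.
Proof.
have mxE11 (M : 'M[R]_1) : M 0 0 = 0 -> M = 0.
  by move=> M0; apply/matrixP => i j; rewrite !ord1 M0 mxE.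
rewrite sub_kermx; apply: (iffP eqP) => [w0|[wu wv]].
  have tan u : (u <= tangent)%MS -> mdot w u = 0.
    move=> /submxP[c ->]; rewrite /mdot trmx_mul !mulmxA -[w *m _ *m _]mulmxA w0.
    by rewrite mul0mx mxE.
  split; apply/tan/span2P; first by exists 1, 0; rewrite scale1r scale0r addr0.
  by exists 0, 1; rewrite scale1r scale0r add0r.
(* After transposition the claim is that the tangent plane lies in the kernel of the functional
   defined by [w], which only has to be checked on the two generators. *)
apply: trmx_inj; rewrite trmx0 !trmx_mul trmxK minkowski_sym -mulmxA.
have ker u : mdot w u = 0 -> (u <= kermx (minkowski_mx R n *m w^T))%MS.
  by rewrite mdotC /mdot -mulmxA => wu0; apply/sub_kermxP/mxE11.
by apply/sub_kermxP; rewrite addsmx_sub !genmxE !ker.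
Qed.

(** The Gram matrix diag(E, -E) is invertible. Trivial intersection is what makes [proj_mx] the
    identity on one summand and zero on the other. *)
Lemma span2_cap_orth : (tangent :&: normal = 0)%MS.
Proof.
apply/eqP; rewrite -submx0; apply/rV_subP => w.
rewrite sub_capmx => /andP[/span2P[k [l ->]] /span2_orthP[]].
rewrite !mdot_lin ee ff ef fe !mulr0 add0r addr0 => /eqP.
rewrite mulf_eq0 (lt_eqF E0) orbF => /eqP -> /eqP.
rewrite mulf_eq0 oppr_eq0 (lt_eqF E0) orbF => /eqP ->.
by rewrite !scale0r addr0 sub0mx.
Qed.

(** The orthogonal projection onto the plane; the minus sign comes from f.f = -E. This form shows
    the smooth dependence on the point that [proj_mx] hides. *)
Definition span2_part a : 'rV[R]_n := (mdot a e / E) *: e - (mdot a f / E) *: f.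

Lemma span2_part_sub a : (span2_part a <= tangent)%MS.
Proof.
by apply/span2P; exists (mdot a e / E), (- (mdot a f / E)); rewrite scaleNr.
Qed.

Lemma sub_span2_part_orth a :
  mdot (a - span2_part a) e = 0 /\ mdot (a - span2_part a) f = 0.
Proof.
have En : E != 0 by rewrite lt_eqF.
by rewrite /span2_part !mdot_lin ee ff ef fe; split; field.
Qed.

Lemma sub_span2_part_l : e - span2_part e = 0.
Proof.
by rewrite /span2_part ee ef mul0r scale0r subr0 divff ?lt_eqF // scale1r subrr.
Qed.

Lemma sub_span2_part_r : f - span2_part f = 0.
Proof.
rewrite /span2_part fe ff mul0r scale0r sub0r mulNr divff ?lt_eqF //.
by rewrite scaleN1r opprK subrr.
Qed.

Lemma span2_proj_orthE a : a *m proj_mx normal tangent = a - span2_part a.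
Proof.
rewrite -[in LHS](subrK (span2_part a) a) mulmxDl.
have C : (normal :&: tangent = 0)%MS.
  by apply/eqP; rewrite -submx0 capmxC span2_cap_orth.
rewrite proj_mx_id ?proj_mx_0 ?span2_part_sub ?addr0 //.
exact/span2_orthP/sub_span2_part_orth.
Qed.

Lemma span2_projE a : a *m proj_mx tangent normal = span2_part a.
Proof.
rewrite -[in LHS](subrK (span2_part a) a) mulmxDl.
rewrite proj_mx_0 ?span2_cap_orth //; last exact/span2_orthP/sub_span2_part_orth.
by rewrite proj_mx_id ?span2_part_sub ?span2_cap_orth // add0r.
Qed.

End Projection.

(** * Curvature of a projection of the flat connection *)

Lemma derive_dirZ (R : realType) (V W : normedModType R) (f : V -> W) p k v :
  differentiable f p -> 'D_(k *: v) f p = k *: 'D_v f p.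
Proof. by move=> df; rewrite !deriveE // linearZ. Qed.

Lemma derive_dirB (R : realType) (V W : normedModType R) (f : V -> W) p v w :
  differentiable f p -> 'D_(v - w) f p = 'D_v f p - 'D_w f p.
Proof. by move=> df; rewrite !deriveE // linearB. Qed.

Lemma derive_dirE (R : realType) (W : normedModType R) (f : R * R -> W) p w :
  differentiable f p -> 'D_w f p = w.1 *: du f p + w.2 *: dv f p.
Proof.
move=> df; rewrite /du /dv -!derive_dirZ // !deriveE // -linearD.
congr ('d f p _); rewrite /eu /ev; case: w => a b.
by congr pair => /=; rewrite /GRing.scale /= !(mulr0, mulr1, addr0, add0r).
Qed.

Lemma smooth_sub (R : realType) (V : normedModType R) (D D' : set (R * R))
    (f : R * R -> V) :
  D' `<=` D -> smooth D f -> smooth D' f.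
Proof.
move=> DD sf k; elim: k f sf => // k IH f sf; split.
- by move=> q /DD; exact: smooth_differentiable.
- by apply: IH; exact: smooth_du.
- by apply: IH; exact: smooth_dv.
Qed.

Section Flat.
Variables (R : realType) (U : set (R * R)) (n : nat) (c : R * R -> R).
Hypotheses (openU : open U) (sc : smooth U c).
Implicit Types (N : R * R -> 'rV[R]_n) (q : R * R).
Let X q : R * R := c q *: eu.
Let Y q : R * R := c q *: ev.

Lemma nablaXE N q : smooth U N -> U q -> nabla X N q = c q *: du N q.
Proof. by move=> sN Uq; apply: derive_dirZ; exact: smooth_differentiable Uq. Qed.

Lemma nablaYE N q : smooth U N -> U q -> nabla Y N q = c q *: dv N q.
Proof. by move=> sN Uq; apply: derive_dirZ; exact: smooth_differentiable Uq. Qed.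

Lemma smooth_nablaX N : smooth U N -> smooth U (nabla X N).
Proof.
move=> sN; apply: (@smooth_ext _ _ openU _ (fun q => c q *: du N q)).
  by move=> q Uq; rewrite nablaXE.
by apply: smoothZ => //; exact: smooth_du.
Qed.

Lemma smooth_nablaY N : smooth U N -> smooth U (nabla Y N).
Proof.
move=> sN; apply: (@smooth_ext _ _ openU _ (fun q => c q *: dv N q)).
  by move=> q Uq; rewrite nablaYE.
by apply: smoothZ => //; exact: smooth_dv.
Qed.

Lemma eq_derive_on (V : normedModType R) (f g : R * R -> V) p v :
  (forall q, U q -> f q = g q) -> U p -> 'D_v f p = 'D_v g p.
Proof. by move=> fg Up; apply: near_eq_derive; exact: open_nearP fg Up. Qed.

Lemma derive_scale (V : normedModType R) (f : R * R -> R) (g : R * R -> V) p v :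
  differentiable f p -> differentiable g p ->
  'D_v (fun q => f q *: g q) p = 'D_v f p *: g p + f p *: 'D_v g p.
Proof. by move=> df dg; rewrite (leibniz_scale df dg).2. Qed.

(** Since second derivatives commute, the commutator retains only the terms in which [c] is
    differentiated, and these are the derivative of N along the bracket. *)
Lemma curv_flat N p : smooth U N -> U p -> curv_of (@nabla R n) X Y N p = 0.
Proof.
move=> sN Up; have sNu := smooth_du sN; have sNv := smooth_dv sN.
have dif (V : normedModType R) (g : R * R -> V) : smooth U g -> differentiable g p.
  by move=> sg; exact: smooth_differentiable Up.
rewrite /curv_of.
have XY : nabla X (nabla Y N) p = c p *: (du c p *: dv N p + c p *: du (dv N) p).
  rewrite (nablaXE (smooth_nablaY sN) Up); congr (_ *: _).
  rewrite -[RHS](derive_scale eu (dif _ _ sc) (dif _ _ sNv)).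
  exact: (eq_derive_on eu (fun q Uq => nablaYE sN Uq) Up).
have YX : nabla Y (nabla X N) p = c p *: (dv c p *: du N p + c p *: dv (du N) p).
  rewrite (nablaYE (smooth_nablaX sN) Up); congr (_ *: _).
  rewrite -[RHS](derive_scale ev (dif _ _ sc) (dif _ _ sNu)).
  exact: (eq_derive_on ev (fun q Uq => nablaXE sN Uq) Up).
have {}XY := etrans XY (congr1
  (fun w => c p *: (du c p *: dv N p + c p *: w)) (smooth_dudv openU sN Up)).
rewrite {}XY {}YX.
have -> : nabla (lie_bracket X Y) N p =
    c p *: (du c p *: dv N p) - c p *: (dv c p *: du N p).
  have dN := dif _ _ sN.
  have br v w : 'D_(c p *: v) (fun q => c q *: w : R * R) p =
      c p *: ('D_v c p *: w).
    rewrite (derive_scale _ (dif _ _ sc) (dif _ _ (smooth_cst openU w))).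
    by rewrite derive_cst scaler0 addr0 (derive_dirZ _ _ (dif _ _ sc)) -scalerA.
  rewrite /nabla /lie_bracket !br (derive_dirB _ _ dN).
  rewrite !(derive_dirZ _ _ dN); reflexivity.
move: (dv N p) (du N p) (dv (du N) p) (du c p) (dv c p) => nv nu nuv cu cv.
rewrite !scalerDr.
move: (c p *: (cu *: nv)) (c p *: (cv *: nu)) (c p *: (_ *: _)) => a b d.
by rewrite opprD addrACA subrr addr0 subrr.
Qed.

Section Projected.
Variables (P C : R * R -> 'M[R]_n) (N V : R * R -> 'rV[R]_n).
Hypotheses (PC : forall q (a : 'rV[R]_n), U q -> a *m P q = a - a *m C q).
Hypothesis (sC : forall f : R * R -> 'rV[R]_n,
  smooth U f -> smooth U (fun q => f q *m C q)).
Hypotheses (sN : smooth U N) (sV : smooth U V).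
Hypothesis (VP : forall q (a : 'rV[R]_n), U q -> mdot (a *m P q) (V q) = mdot a (V q)).
Hypothesis (VC : forall q (a : 'rV[R]_n), U q -> mdot (a *m C q) (V q) = 0).

Let nablaP Z M : R * R -> 'rV[R]_n := fun q => nabla Z M q *m P q.

(** The part removed by the projection is orthogonal to V. Differentiating that orthogonality moves
    the derivative from the removed part to V, with a change of sign. *)
Let nabla_nablaP Z W p : U p -> smooth U (nabla W N) ->
  mdot (nabla Z (nablaP W N) p) (V p) =
    mdot (nabla Z (nabla W N) p) (V p) + mdot (nabla W N p *m C p) (nabla Z V p).
Proof.
move=> Up sW; have sWC := sC sW.
have dif (f : R * R -> 'rV[R]_n) : smooth U f -> differentiable f p.
  by move=> sf; exact: smooth_differentiable Up.
have E q : U q -> nablaP W N q = nabla W N q - nabla W N q *m C q by exact: PC.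
rewrite {1}/nabla (eq_derive_on (Z p) E Up).
rewrite (deriveB (diff_derivable (dif _ sW)) (diff_derivable (dif _ sWC))).
rewrite mdotDl mdotNl; congr (_ + _).
have /esym := (leibniz_mdot (dif _ sWC) (dif _ sV)).2 (Z p).
rewrite (eq_derive_on (Z p) (fun q Uq => VC (nabla W N q) Uq) Up) derive_cst.
by move/eqP; rewrite addr_eq0 => /eqP ->; rewrite opprK.
Qed.

(** By flatness only the corrections of [nabla_nablaP] survive. With P tangential and C normal this
    becomes the Gauss equation, with the roles exchanged the Ricci equation. *)
Lemma mdot_curv_proj p : U p ->
  mdot (curv_of nablaP X Y N p) (V p) =
    mdot (nabla Y N p *m C p) (nabla X V p) - mdot (nabla X N p *m C p) (nabla Y V p).
Proof.
move=> Up.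
have VPp Z M : mdot (nablaP Z M p) (V p) = mdot (nabla Z M p) (V p) := VP _ Up.
have EX := nabla_nablaP X Up (smooth_nablaY sN).
have EY := nabla_nablaP Y Up (smooth_nablaX sN).
have flat := congr1 (fun v => mdot v (V p)) (curv_flat sN Up).
rewrite /= /curv_of mdot0l !mdotDl !mdotNl in flat.
rewrite /curv_of !mdotDl !mdotNl.
have cancel (a b a' d l : R) : a - a' - l = 0 -> a + b - (a' + d) - l = b - d.
  by move=> acl; apply: etrans (_ : a - a' - l + (b - d) = _); [ring|rewrite acl add0r].
apply: etrans (cancel _ _ _ _ _ flat).
pose sub3 (a b d : R) := a - b - d.
apply: etrans (f_equal2 (fun a b => sub3 a b _) EX EY).
exact: etrans (f_equal2 (fun a b => sub3 a b _) (VPp X _) (VPp Y _))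
  (congr1 (sub3 _ _) (VPp _ N)).
Qed.

End Projected.
End Flat.

(** * Isothermal coordinates *)

Section Dnum.
Variables (R : realType) (n : nat).
Implicit Types a b : 'rV[R]_n.

Lemma dvecE a b i : dvec a b 0 i = DNum (a 0 i) (b 0 i).
Proof.
by rewrite !mxE; congr DNum => /=; rewrite !(mul0r, mul1r, addr0, add0r).
Qed.

Lemma dre_dvec a b : map_mx (@dre R) (dvec a b) = a.
Proof. by apply/rowP => i; rewrite mxE dvecE. Qed.

Lemma dim_dvec a b : map_mx (@Defs.dim R) (dvec a b) = b.
Proof. by apply/rowP => i; rewrite mxE dvecE. Qed.

Lemma dnum_sum I (r : seq I) (P : pred I) (F G : I -> R) :
  \sum_(i <- r | P i) DNum (F i) (G i) =
  DNum (\sum_(i <- r | P i) F i) (\sum_(i <- r | P i) G i).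
Proof. by elim/big_rec3: _ => // i y1 y2 y3 _ ->. Qed.

Lemma mdot_dvec a b :
  mdot (dvec a b) (dvec a b) = DNum (mdot a a + mdot b b) (2 * mdot a b).
Proof.
rewrite !mdotE mulr_sumr -big_split /= -dnum_sum; apply: eq_bigr => i _.
by rewrite !dvecE; case: eqP => _; congr DNum => /=; ring.
Qed.

Lemma dvec_mul a b (M : 'M[R]_n) :
  dvec a b *m map_mx (@dnumC R) M = dvec (a *m M) (b *m M).
Proof.
apply/rowP => i; rewrite dvecE !mxE -dnum_sum; apply: eq_bigr => j _.
by rewrite dvecE mxE; congr DNum => /=; rewrite mulr0 ?addr0 ?add0r.
Qed.

Lemma dvec_eqP (s : 'rV[dnum R]_n) a b :
  (forall i, s 0 i = DNum (a 0 i) (b 0 i)) -> s = dvec a b.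
Proof. by move=> sE; apply/rowP => i; apply: etrans (sE i) (esym (dvecE a b i)). Qed.

Lemma dvecD a b a' b' : dvec a b + dvec a' b' = dvec (a + a') (b + b').
Proof.
apply: dvec_eqP => i.
apply: etrans (_ : _ = dvec a b 0 i + dvec a' b' 0 i) _; first by rewrite [LHS]mxE.
apply: etrans (f_equal2 _ (dvecE a b i) (dvecE a' b' i)) _.
by congr DNum; rewrite mxE.
Qed.

Lemma dnumjZ_dvec a b : dnumj R *: dvec a b = dvec b a.
Proof.
apply: dvec_eqP => i.
apply: etrans (_ : _ = dnumj R * dvec a b 0 i) _; first by rewrite [LHS]mxE.
apply: etrans (f_equal2 _ (erefl _) (dvecE a b i)) _.
by congr DNum => /=; ring.
Qed.

Lemma dnumCZ_dvec k a b : dnumC k *: dvec a b = dvec (k *: a) (k *: b).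
Proof.
apply: dvec_eqP => i.
apply: etrans (_ : _ = dnumC k * dvec a b 0 i) _; first by rewrite [LHS]mxE.
apply: etrans (f_equal2 _ (erefl _) (dvecE a b i)) _.
by congr DNum => /=; rewrite mxE; ring.
Qed.

End Dnum.

Lemma ddt_PhiE (R : realType) (n : nat) (x : R * R -> 'rV[R]_n) p :
  ddt (Phi x) p = dvec (2^-1 *: (du (du x) p + dv (dv x) p))
                       (2^-1 *: (du (dv x) p + dv (du x) p)).
Proof.
rewrite /ddt /Phi.
have -> : (fun q => map_mx (@dre R) (dvec (du x q) (dv x q))) = du x.
  by apply/funext => q; rewrite dre_dvec.
have -> : (fun q => map_mx (@Defs.dim R) (dvec (du x q) (dv x q))) = dv x.
  by apply/funext => q; rewrite dim_dvec.
by rewrite dnumjZ_dvec dvecD dnumCZ_dvec.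
Qed.

Lemma derive_lin2 (R : realType) (V W : normedModType R) (a b : R) (f g : V -> W) p v :
  differentiable f p -> differentiable g p ->
  'D_v (fun q => a *: f q + b *: g q) p = a *: 'D_v f p + b *: 'D_v g p.
Proof.
move=> /(@diff_derivable _ _ _ _ _ v) df /(@diff_derivable _ _ _ _ _ v) dg.
rewrite -!deriveZ //; apply: deriveD; exact: derivableZ.
Qed.

Lemma lin2_mulmx0 (R : comNzRingType) n (a b : R) (u v : 'rV[R]_n) (M : 'M[R]_n) :
  u *m M = 0 -> v *m M = 0 -> (a *: u + b *: v) *m M = 0.
Proof. by move=> u0 v0; rewrite mulmxDl -!scalemxAl u0 v0 !scaler0 addr0. Qed.

Lemma mdot_scaled_frame (R : realType) n (e f : 'rV[R]_n) (E k : R) :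
  mdot e e = E -> mdot f f = - E -> mdot e f = 0 -> E < 0 ->
  k ^+ 2 = (- E)^-1 ->
  [/\ mdot (k *: e) (k *: e) = -1, mdot (k *: f) (k *: f) = 1 &
      mdot (k *: e) (k *: f) = 0].
Proof.
move=> ee ff ef E0 k2; have En : E != 0 by rewrite lt_eqF.
rewrite !mdot_lin ee ff ef !mulrA -!expr2 k2 !mulr0.
by split=> //; field; rewrite ?oppr_eq0.
Qed.

(** For w = (a, b), the vectors [h], [g1], [g2] stand for the derivatives of 'D_w x along w, u and
    v, and [M] for the normal projection. *)
Lemma quadratic_mulmx (R : comNzRingType) n (a b : R) (M : 'M[R]_n)
    (h g1 g2 uu uv vu vv : 'rV[R]_n) :
  h = a *: g1 + b *: g2 -> g1 = a *: uu + b *: uv -> g2 = a *: vu + b *: vv ->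
  uv = vu ->
  h *m M = a ^+ 2 *: (uu *m M) + (2 * (a * b)) *: (uv *m M) + b ^+ 2 *: (vv *m M).
Proof.
move=> -> -> -> <-; rewrite !scalemxAl -!mulmxDl; congr (_ *m _).
rewrite !scalerDr !scalerA !addrA -!expr2; congr (_ + _).
by rewrite -!addrA -scalerDl; congr (_ + _ *: _); ring.
Qed.

(** * Projections and second fundamental form in isothermal coordinates *)

Section Isothermal.
Variables (R : realType) (n : nat) (U : set (R * R)) (x : R * R -> 'rV[R]_n).
Hypotheses (openU : open U) (sx : smooth U x) (iso : isothermal x U).
Implicit Types (q : R * R) (a : 'rV[R]_n).
Local Notation E := (metricE x).

Let sxu := smooth_du sx.
Let sxv := smooth_dv sx.

Lemma iso_E0 q : U q -> E q < 0. Proof. by case/iso. Qed.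
Lemma iso_uu q : mdot (du x q) (du x q) = E q. Proof. by []. Qed.
Lemma iso_vv q : U q -> mdot (dv x q) (dv x q) = - E q.
Proof. by case/iso => -> _ _; rewrite opprK. Qed.
Lemma iso_uv q : U q -> mdot (du x q) (dv x q) = 0.
Proof. by case/iso. Qed.

Lemma smooth_E : smooth U E.
Proof. exact: smooth_mdot. Qed.

(** The scale that makes x_u and x_v an orthonormal frame. *)
Definition conformal_factor q := (Num.sqrt (- E q))^-1.
Local Notation c := conformal_factor.

Lemma conformal_factor_gt0 q : U q -> 0 < c q.
Proof. by move=> Uq; rewrite invr_gt0 sqrtr_gt0 oppr_gt0 iso_E0. Qed.

Lemma conformal_factor_sqr q : U q -> c q ^+ 2 = (- E q)^-1.
Proof. by move=> Uq; rewrite exprVn sqr_sqrtr // oppr_ge0 ltW ?iso_E0. Qed.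

Lemma smooth_conformal_factor : smooth U c.
Proof.
apply: smoothV => // [q Uq|]; first by rewrite gt_eqF // sqrtr_gt0 oppr_gt0 iso_E0.
apply: smooth_sqrt => // [q Uq|]; first by rewrite oppr_gt0 iso_E0.
exact: smoothN smooth_E.
Qed.

Lemma normal_projE q a : U q ->
  a *m normal_proj x q = a - span2_part (du x q) (dv x q) (E q) a.
Proof.
move=> Uq; exact: span2_proj_orthE (iso_uu q) (iso_vv Uq) (iso_uv Uq) (iso_E0 Uq) a.
Qed.

Lemma tangent_projE q a : U q ->
  a *m tangent_proj x q = span2_part (du x q) (dv x q) (E q) a.
Proof.
move=> Uq; exact: span2_projE (iso_uu q) (iso_vv Uq) (iso_uv Uq) (iso_E0 Uq) a.
Qed.

Lemma normal_proj_orth q a : U q ->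
  mdot (a *m normal_proj x q) (du x q) = 0 /\
  mdot (a *m normal_proj x q) (dv x q) = 0.
Proof.
move=> Uq; rewrite (normal_projE a Uq).
exact: sub_span2_part_orth (iso_uu q) (iso_vv Uq) (iso_uv Uq) (iso_E0 Uq) a.
Qed.

Lemma smooth_tangent (f : R * R -> 'rV[R]_n) :
  smooth U f -> smooth U (fun q => f q *m tangent_proj x q).
Proof.
move=> sf; have sEV : smooth U (fun q => (E q)^-1).
  apply: smoothV => // [q Uq|]; last exact: smooth_E.
  by rewrite lt_eqF // iso_E0.
exact (smooth_ext openU (fun q Uq => esym (tangent_projE (f q) Uq)) (smoothB openU
  (smoothZ openU (smoothM openU (smooth_mdot openU sf sxu) sEV) sxu)
  (smoothZ openU (smoothM openU (smooth_mdot openU sf sxv) sEV) sxv))).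
Qed.

Lemma smooth_normal (f : R * R -> 'rV[R]_n) :
  smooth U f -> smooth U (fun q => f q *m normal_proj x q).
Proof.
move=> sf.
have E q : U q -> f q - f q *m tangent_proj x q = f q *m normal_proj x q.
  by move=> Uq; rewrite (tangent_projE _ Uq) (normal_projE _ Uq).
exact (smooth_ext openU E (smoothB openU sf (smooth_tangent sf))).
Qed.

Lemma derive_push w q : U q -> 'D_w x q = w.1 *: du x q + w.2 *: dv x q.
Proof. by move=> Uq; apply: derive_dirE; exact: smooth_differentiable sx Uq. Qed.

Lemma smooth_push w : smooth U ('D_w x).
Proof.
have E q : U q -> w.1 *: du x q + w.2 *: dv x q = 'D_w x q.
  by move=> Uq; rewrite (derive_push w Uq).
exact (smooth_ext openU E (smoothD openU
  (smoothZ openU (smooth_cst openU w.1) sxu)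
  (smoothZ openU (smooth_cst openU w.2) sxv))).
Qed.

Lemma push_normal0 w q : U q -> 'D_w x q *m normal_proj x q = 0.
Proof.
move=> Uq; have vv := iso_vv Uq; have uv := iso_uv Uq; have E0 := iso_E0 Uq.
have u0 := etrans (normal_projE _ Uq) (sub_span2_part_l (iso_uu q) uv E0).
have v0 := etrans (normal_projE _ Uq) (sub_span2_part_r vv uv E0).
apply: etrans (congr1 (mulmx^~ _) (derive_push w Uq)) _.
exact: lin2_mulmx0 u0 v0.
Qed.

Lemma second_ff_cst v w q :
  second_ff x (cst v) (cst w) q = 'D_v ('D_w x) q *m normal_proj x q.
Proof. by []. Qed.

(** The term in which [k] is differentiated is a multiple of the tangent vector 'D_w x, which the
    normal projection kills. This reduces the varying frame to constant coordinate fields. *)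
Lemma second_ffE (k : R * R -> R) v w q : smooth U k -> U q ->
  second_ff x (fun z => k z *: v) (fun z => k z *: w) q =
  k q ^+ 2 *: second_ff x (cst v) (cst w) q.
Proof.
move=> sk Uq; rewrite second_ff_cst /second_ff /nabla.
have dif (V : normedModType R) (g : R * R -> V) : smooth U g -> differentiable g q.
  by move=> sg; exact: smooth_differentiable Uq.
have E z : U z -> push x (fun z => k z *: w) z = k z *: 'D_w x z.
  by move=> Uz; apply: derive_dirZ; exact: smooth_differentiable sx Uz.
apply: etrans (congr1 (mulmx^~ _) (eq_derive_on openU (k q *: v) E Uq)) _.
rewrite (derive_dirZ _ _ (dif _ _ (smoothZ openU sk (smooth_push w)))).
rewrite (derive_scale v (dif _ _ sk) (dif _ _ (smooth_push w))).
move: (push_normal0 w Uq); move: ('D_w x q) ('D_v _ q) ('D_v _ q) => a k' b a0.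
by rewrite -scalemxAl mulmxDl -!scalemxAl a0 scaler0 add0r scalerA expr2.
Qed.

Lemma second_ff_cstZ (k : R) v w q : U q ->
  second_ff x (cst (k *: v)) (cst (k *: w)) q =
  k ^+ 2 *: second_ff x (cst v) (cst w) q.
Proof. exact: (second_ffE v w (smooth_cst openU k)). Qed.

Lemma second_ff_quadratic w q : U q ->
  second_ff x (cst w) (cst w) q =
  w.1 ^+ 2 *: second_ff x (cst eu) (cst eu) q +
  (2 * (w.1 * w.2)) *: second_ff x (cst eu) (cst ev) q +
  w.2 ^+ 2 *: second_ff x (cst ev) (cst ev) q.
Proof.
move=> Uq; have dw := smooth_differentiable (smooth_push w) Uq.
have E v : 'D_v ('D_w x) q = w.1 *: 'D_v (du x) q + w.2 *: 'D_v (dv x) q.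
  apply: etrans (eq_derive_on openU v (fun z Uz => derive_push w Uz) Uq) _.
  exact: (derive_lin2 _ _ v (smooth_differentiable sxu Uq)
                            (smooth_differentiable sxv Uq)).
have uv : du (dv x) q = dv (du x) q := smooth_dudv openU sx Uq.
exact: (quadratic_mulmx _ (derive_dirE w dw) (E eu) (E ev) uv).
Qed.

Hypothesis min : minimal x U.

(** On the constant fields with the values of the orthonormal frame at q, the mean curvature is half
    of c^2 times the difference of the two sides. *)
Lemma minimal_second_ff q : U q ->
  second_ff x (cst ev) (cst ev) q = second_ff x (cst eu) (cst eu) q.
Proof.
move=> Uq; have dx := smooth_differentiable sx Uq.
have c2 := conformal_factor_sqr Uq; have E0 := iso_E0 Uq.
have /(min Uq) : orthonormal_at x (cst (c q *: eu)) (cst (c q *: ev)) q.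
  rewrite /orthonormal_at /induced_metric /push /cst !(derive_dirZ _ _ dx).
  exact: mdot_scaled_frame (iso_uu q) (iso_vv Uq) (iso_uv Uq) E0 c2.
rewrite /mean_curvature !(second_ff_cstZ _ _ _ Uq) => /eqP.
rewrite scaler_eq0 invr_eq0 pnatr_eq0 /= addrC subr_eq0 => /eqP.
by apply: scalerI; rewrite sqrf_eq0 gt_eqF // conformal_factor_gt0.
Qed.

End Isothermal.

(** * Axes of a hyperbola *)

Section HyperbolaAxes.
Variables (R : realType) (n : nat) (a b : 'rV[R]_n).
Hypotheses (aa : 0 < mdot a a) (bb : 0 < mdot b b) (ab : mdot a b = 0).

Lemma mnorm_gt0 (v : 'rV[R]_n) : 0 < mdot v v -> 0 < mnorm v.
Proof. by move=> v0; rewrite sqrtr_gt0. Qed.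

Lemma mnorm_sqr (v : 'rV[R]_n) : 0 < mdot v v -> mnorm v ^+ 2 = mdot v v.
Proof. by move=> v0; rewrite sqr_sqrtr // ltW. Qed.

Lemma mdot_unit (v : 'rV[R]_n) : 0 < mdot v v ->
  mdot ((mnorm v)^-1 *: v) ((mnorm v)^-1 *: v) = 1.
Proof.
move=> v0; rewrite mdotZl mdotZr -(mnorm_sqr v0).
by field; rewrite gt_eqF // mnorm_gt0.
Qed.

Fact unit_frame : [/\ mdot ((mnorm a)^-1 *: a) ((mnorm a)^-1 *: a) = 1,
  mdot ((mnorm b)^-1 *: b) ((mnorm b)^-1 *: b) = 1 &
  mdot ((mnorm a)^-1 *: a) ((mnorm b)^-1 *: b) = 0].
Proof. by rewrite !mdot_unit // mdotZl mdotZr ab !mulr0. Qed.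

Definition axes_hyperbola : hyperbola R n :=
  Hyperbola unit_frame (conj (mnorm_gt0 aa) (mnorm_gt0 bb)).

(* The double-angle form of the branch: y = sinh psi, z = cosh psi. *)
Definition double_angle_set : set 'rV[R]_n :=
  [set v | exists y z, z ^+ 2 - y ^+ 2 = 1 /\
     v = (y ^+ 2 + z ^+ 2) *: a + (2 * (y * z)) *: b].

Lemma double_angle_branch : double_angle_set = branch axes_hyperbola false.
Proof.
have na := mnorm_gt0 aa; have nb := mnorm_gt0 bb.
have na0 : mnorm a != 0 by rewrite gt_eqF.
have nb0 : mnorm b != 0 by rewrite gt_eqF.
apply/seteqP; split=> v /=.
  move=> [y [z [yz ->]]].
  have z2 : z ^+ 2 = 1 + y ^+ 2 by rewrite -yz subrK.
  exists ((y ^+ 2 + z ^+ 2) * mnorm a), (2 * (y * z) * mnorm b).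
  split=> /=; first by rewrite !scalerA !mulfK.
    rewrite ![(_ * mnorm _) ^+ 2]exprMn !mulfK ?sqrf_eq0 //.
    rewrite (_ : _ - _ = (z ^+ 2 - y ^+ 2) ^+ 2); last by ring.
    by rewrite yz expr1n.
  by rewrite expr0 mul1r mulr_gt0 // z2; have := sqr_ge0 y; lra.
move=> [s [t [-> /= st]]]; rewrite expr0 mul1r => s0.
pose S := s / mnorm a; pose T := t / mnorm b.
have ST : S ^+ 2 - T ^+ 2 = 1 by rewrite -st !expr_div_n.
have S0 : 0 < S by rewrite divr_gt0.
(* Half-angle formulas: S = cosh 2psi and T = sinh 2psi give cosh psi = sqrt((S + 1) / 2) and sinh
   psi = T / (2 cosh psi). *)
pose z := Num.sqrt ((S + 1) / 2).
have z2 : z ^+ 2 = (S + 1) / 2 by rewrite sqr_sqrtr; lra.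
have z0 : z != 0 by rewrite -sqrf_eq0 z2 gt_eqF //; lra.
clearbody z.
have y2 : (T / (2 * z)) ^+ 2 = (S - 1) / 2.
  have -> : (T / (2 * z)) ^+ 2 = T ^+ 2 / (4 * z ^+ 2) by field.
  rewrite z2 (_ : T ^+ 2 = S ^+ 2 - 1); last by lra.
  by field; rewrite gt_eqF //; lra.
exists (T / (2 * z)), z; rewrite y2 z2; split; first by field.
rewrite !scalerA; congr (_ *: _ + _ *: _); first by rewrite -/S; field.
by rewrite -/T; field.
Qed.

Lemma mdot_frame (h : hyperbola R n) s t s' t' :
  mdot (s *: hyp_e1 h + t *: hyp_e2 h) (s' *: hyp_e1 h + t' *: hyp_e2 h) =
  s * s' + t * t'.
Proof.
have [e11 e22 e12] := hyp_orthonormal h.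
by rewrite !mdot_lin (mdotC (hyp_e2 h)) e11 e22 e12; ring.
Qed.

(* The vertex is the point of a branch nearest to the centre, so it is
   determined by the branch. *)
Lemma branch_axes (h : hyperbola R n) neg : double_angle_set = branch h neg ->
  [/\ real_axis h a, mnorm a = real_semiaxis h,
      conjugate_axis h b & mnorm b = conjugate_semiaxis h].
Proof.
move=> Sh; have [ha hb] := hyp_semiaxes_gt0 h.
have ha2 : 0 < hyp_a h ^+ 2 by rewrite exprn_gt0.
have hb2 : 0 < hyp_b h ^+ 2 by rewrite exprn_gt0.
have [s0 [t0 [aE st0 _]]] : branch h neg a.
  rewrite -Sh; exists 0, 1; split; first by rewrite expr1n expr0n subr0.
  by rewrite expr1n expr0n add0r scale1r mul0r mulr0 scale0r addr0.
have aE2 : mdot a a = s0 ^+ 2 + t0 ^+ 2 by rewrite {1 2}aE mdot_frame -!expr2.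
have s0E : s0 ^+ 2 = hyp_a h ^+ 2 * (1 + t0 ^+ 2 / hyp_b h ^+ 2).
  by rewrite -st0 subrK mulrC divfK ?gt_eqF.
(* The vertex of [h] on this branch belongs to the set, so it is cosh(2psi) a + sinh(2psi) b for
   some psi; as a.b = 0, its square is at least a.a. *)
have le_a : mdot a a <= hyp_a h ^+ 2.
  have : double_angle_set ((-1) ^+ neg * hyp_a h *: hyp_e1 h).
    rewrite Sh; exists ((-1) ^+ neg * hyp_a h), 0; split.
    - by rewrite scale0r addr0.
    - by rewrite exprMn sqrr_sign mul1r expr0n mul0r subr0 divff ?gt_eqF.
    - by rewrite mulrA -expr2 sqrr_sign mul1r.
  move=> [y [z [yz E]]].
  have -> : hyp_a h ^+ 2 =
      (y ^+ 2 + z ^+ 2) ^+ 2 * mdot a a + (2 * (y * z)) ^+ 2 * mdot b b.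
    have := mdot_frame h ((-1) ^+ neg * hyp_a h) 0 ((-1) ^+ neg * hyp_a h) 0.
    rewrite scale0r addr0 mul0r addr0 -expr2 exprMn sqrr_sign mul1r => <-.
    by rewrite {1 2}E !mdot_lin (mdotC b) ab; ring.
  have -> : (y ^+ 2 + z ^+ 2) ^+ 2 = 1 + (2 * (y * z)) ^+ 2.
    rewrite (_ : (_ + _) ^+ 2 = (z ^+ 2 - y ^+ 2) ^+ 2 + (2 * (y * z)) ^+ 2).
      by rewrite yz expr1n.
    by ring.
  rewrite mulrDl mul1r -addrA lerDl.
  by rewrite addr_ge0 // mulr_ge0 ?sqr_ge0 // ltW.
(* By [s0E], a.a exceeds the square of the real semi-axis by nonnegative multiples of t0^2, one of
   them t0^2 itself; [le_a] leaves no room for them. *)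
have t00 : t0 = 0.
  apply/eqP; rewrite -sqrf_eq0 eq_le sqr_ge0 andbT.
  have : 0 <= hyp_a h ^+ 2 * (t0 ^+ 2 / hyp_b h ^+ 2).
    by rewrite mulr_ge0 ?divr_ge0 ?sqr_ge0.
  by move: le_a; rewrite aE2 s0E; lra.
have s0a : s0 ^+ 2 = hyp_a h ^+ 2 by rewrite s0E t00 expr0n mul0r addr0 mulr1.
have aa_a : mdot a a = hyp_a h ^+ 2 by rewrite aE2 t00 expr0n addr0.
have ae : a = s0 *: hyp_e1 h by rewrite {1}aE t00 scale0r addr0.
have s00 : s0 != 0 by rewrite -sqrf_eq0 s0a gt_eqF.
have ea : mnorm a = hyp_a h by rewrite /mnorm aa_a sqrtr_sqr gtr0_norm.
(* y = 3/4, z = 5/4 is a rational point on z^2 - y^2 = 1 *)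
have [s1 [t1 [vE st1 _]]] : branch h neg ((17 / 8) *: a + (15 / 8) *: b).
  rewrite -Sh; exists (3 / 4), (5 / 4); split; first by field.
  by congr (_ *: _ + _ *: _); field.
(* Pairing the second point with [a], now known to lie along [hyp_e1], isolates its first
   coordinate; what remains puts [b] along [hyp_e2]. *)
have s1E : s1 = 17 / 8 * s0.
  apply: (mulIf s00).
  have := mdot_frame h s1 t1 s0 0; rewrite -vE scale0r addr0 -ae mulr0 addr0 => <-.
  by rewrite mdotDl !mdotZl (mdotC b) ab mulr0 addr0 aE2 t00; ring.
have bE : b = (8 / 15 * t1) *: hyp_e2 h.
  have : (15 / 8) *: b = t1 *: hyp_e2 h.
    apply: (addrI ((17 / 8) *: a)); rewrite vE; congr (_ + _).
    by rewrite {1}ae scalerA s1E.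
  move=> /(congr1 ( *:%R (8 / 15))); rewrite !scalerA => <-.
  by rewrite (_ : 8 / 15 * _ = 1) ?scale1r //; field.
have t1E : t1 ^+ 2 = (15 / 8 * hyp_b h) ^+ 2.
  have h0 : hyp_b h ^+ 2 != 0 by rewrite gt_eqF.
  have : s1 ^+ 2 / hyp_a h ^+ 2 = (17 / 8) ^+ 2.
    by rewrite s1E exprMn s0a mulfK // gt_eqF.
  move=> E1; move: st1; rewrite E1 => E2.
  have : t1 ^+ 2 / hyp_b h ^+ 2 = (15 / 8) ^+ 2 by lra.
  by move=> E3; rewrite exprMn -E3 divfK.
have eb : mnorm b = hyp_b h.
  have [_ e22 _] := hyp_orthonormal h.
  rewrite /mnorm bE mdotZl mdotZr e22 mulr1 -expr2 exprMn t1E.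
  rewrite (_ : _ * _ = hyp_b h ^+ 2); last by field.
  by rewrite sqrtr_sqr gtr0_norm.
split=> //; first by exists s0.
by exists (8 / 15 * t1).
Qed.

End HyperbolaAxes.

(** * Gauss and Ricci equations *)

Lemma mdot_lin2_0 (R : comNzRingType) n (v e f : 'rV[R]_n) k l :
  mdot v e = 0 -> mdot v f = 0 -> mdot v (k *: e + l *: f) = 0.
Proof. by move=> ve vf; rewrite mdotDr !mdotZr ve vf !mulr0 addr0. Qed.

Section Curvature.
Variables (R : realType) (n : nat) (U : set (R * R)) (x : R * R -> 'rV[R]_n).
Hypotheses (openU : open U) (sx : smooth U x) (iso : isothermal x U).
Hypothesis min : minimal x U.
Implicit Types (q : R * R) (a b : 'rV[R]_n).
Local Notation E := (metricE x).
Local Notation c := (conformal_factor x).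
Local Notation sff v w := (second_ff x (cst v) (cst w)).

Let X1 q : R * R := c q *: eu.
Let X2 q : R * R := c q *: ev.
Let sc : smooth U c. Proof. exact: smooth_conformal_factor. Qed.

Lemma sff_sym q : U q -> sff ev eu q = sff eu ev q.
Proof.
move=> Uq; exact: (congr1 (mulmx^~ _) (esym (smooth_dudv openU sx Uq))).
Qed.

Lemma smooth_sff v w : smooth U ('D_v ('D_w x)) -> smooth U (sff v w).
Proof. by move=> s; exact: (smooth_normal openU sx iso s). Qed.

Lemma smooth_sff_uu : smooth U (sff eu eu).
Proof. exact: smooth_sff (smooth_du (smooth_du sx)). Qed.

Lemma smooth_sff_uv : smooth U (sff eu ev).
Proof. exact: smooth_sff (smooth_du (smooth_dv sx)). Qed.

Lemma mdot_normal_push q a w : U q ->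
  mdot (a *m normal_proj x q) ('D_w x q) = 0.
Proof.
move=> Uq; have [au av] := normal_proj_orth iso a Uq.
apply: etrans (congr1 (mdot _) (derive_push sx w Uq)) _.
exact: mdot_lin2_0 au av.
Qed.

Lemma tangent_add_normal q a : U q ->
  a = a *m tangent_proj x q + a *m normal_proj x q.
Proof.
by move=> Uq; rewrite (tangent_projE iso a Uq) (normal_projE iso a Uq) addrC subrK.
Qed.

Lemma mdot_tangent q a v : U q ->
  mdot v (du x q) = 0 -> mdot v (dv x q) = 0 -> mdot (a *m tangent_proj x q) v = 0.
Proof.
move=> Uq vu vv; rewrite (tangent_projE iso a Uq) mdotC.
move: vu vv; rewrite /span2_part; move: (du x q) (dv x q) => e f ve vf.
by rewrite !mdot_lin ve vf !mulr0 subrr.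
Qed.

Lemma mdot_normal_proj q a b : U q ->
  mdot (a *m normal_proj x q) b =
  mdot (a *m normal_proj x q) (b *m normal_proj x q).
Proof.
move=> Uq; rewrite [in LHS](tangent_add_normal b Uq) mdotDr.
have [au av] := normal_proj_orth iso a Uq.
by rewrite [mdot _ (b *m tangent_proj x q)]mdotC (mdot_tangent b Uq au av) add0r.
Qed.

Lemma second_ff_frame v w q : U q ->
  second_ff x (fun z => c z *: v) (fun z => c z *: w) q =
  (- E q)^-1 *: sff v w q.
Proof.
move=> Uq; rewrite -(conformal_factor_sqr iso Uq).
exact: (second_ffE openU sx iso v w sc Uq).
Qed.

(** [mdot_curv_proj] for the tangential projection, with N = X2 and V = X1, gives K =
    -sigma(X2,X2).sigma(X1,X1) + sigma(X1,X2).sigma(X2,X1); minimality and symmetry then remove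
    sigma(X2,X2) and sigma(X2,X1). *)
Lemma gauss_equation q : U q ->
  gauss_curvature x X1 X2 q =
  (- E q)^-1 ^+ 2 * (mdot (sff eu ev q) (sff eu ev q)
                      - mdot (sff eu eu q) (sff eu eu q)).
Proof.
move=> Uq; rewrite /gauss_curvature.
have VP z (a : 'rV[R]_n) : U z ->
    mdot (a *m tangent_proj x z) (push x X1 z) = mdot a (push x X1 z).
  move=> Uz; rewrite [in RHS](tangent_add_normal a Uz) mdotDl.
  by rewrite (mdot_normal_push a _ Uz) addr0.
have TN z (a : 'rV[R]_n) : U z ->
    a *m tangent_proj x z = a - a *m normal_proj x z.
  by move=> Uz; apply/eqP; rewrite eq_sym subr_eq; apply/eqP/tangent_add_normal.
have := mdot_curv_proj openU sc TN (smooth_normal openU sx iso)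
  (smooth_nablaY openU sc sx) (smooth_nablaX openU sc sx) VP
  (fun z a Uz => mdot_normal_push a _ Uz) Uq.
rewrite -[mdot (curv_of _ _ _ _ q) _]/(mdot (curvT x X1 X2 X2 q) (push x X1 q)).
move=> ->.
have K (a b a' b' : 'rV[R]_n) :
    mdot (a *m normal_proj x q) b - mdot (a' *m normal_proj x q) b' =
    mdot (a *m normal_proj x q) (b *m normal_proj x q)
    - mdot (a' *m normal_proj x q) (b' *m normal_proj x q).
  by rewrite (mdot_normal_proj a b Uq) (mdot_normal_proj a' b' Uq).
rewrite K.
have E11 := second_ff_frame eu eu Uq.
have E12 := second_ff_frame eu ev Uq.
have E21 := etrans (second_ff_frame ev eu Uq) (congr1 _ (sff_sym Uq)).
have E22 := etrans (second_ff_frame ev ev Uq)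
  (congr1 _ (minimal_second_ff openU sx iso min Uq)).
change (- (mdot (second_ff x X2 X2 q) (second_ff x X1 X1 q)
  - mdot (second_ff x X1 X2 q) (second_ff x X2 X1 q)) =
  (- E q)^-1 ^+ 2 * (mdot (sff eu ev q) (sff eu ev q)
                      - mdot (sff eu eu q) (sff eu eu q))).
rewrite {}E11 {}E12 {}E21 {}E22.
move: (sff eu eu q) (sff eu ev q) (_^-1) => a b k.
by rewrite !mdotZl !mdotZr; ring.
Qed.

Definition normal_field (N : R * R -> 'rV[R]_n) :=
  forall q, U q -> mdot (N q) (du x q) = 0 /\ mdot (N q) (dv x q) = 0.

(** Weingarten's relation, from differentiating N.('D_w x) = 0. *)
Lemma mdot_derive_normal N v w q : smooth U N -> normal_field N -> U q ->
  mdot ('D_v N q) ('D_w x q) = - mdot (N q) (sff v w q).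
Proof.
move=> sN nN Uq; have [Nu Nv] := nN q Uq.
have Nx z : U z -> mdot (N z) ('D_w x z) = 0.
  move=> Uz; have [zu zv] := nN z Uz.
  apply: etrans (congr1 (mdot _) (derive_push sx w Uz)) _.
  exact: mdot_lin2_0 zu zv.
have /esym := (leibniz_mdot (smooth_differentiable sN Uq)
  (smooth_differentiable (smooth_push openU sx w) Uq)).2 v.
rewrite (eq_derive_on openU v Nx Uq) derive_cst => /eqP.
rewrite addr_eq0 => /eqP ->; congr (- _).
rewrite [in LHS](tangent_add_normal ('D_v ('D_w x) q) Uq) mdotDr.
by rewrite mdotC (mdot_tangent _ Uq Nu Nv) add0r.
Qed.

Lemma mdot_tangent_proj q a b : U q ->
  mdot (a *m tangent_proj x q) b =
  (mdot a (du x q) * mdot b (du x q) - mdot a (dv x q) * mdot b (dv x q)) / E q.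
Proof.
move=> Uq; rewrite (tangent_projE iso a Uq) /span2_part.
move: (du x q) (dv x q) (E q) => e f k.
by rewrite !mdot_lin (mdotC e) (mdotC f); ring.
Qed.

(** By Weingarten's relation every derivative of N and V pairs with x_u and x_v through sigma. The
    factor 2 arises because, sigma(ev,ev) being equal to sigma(eu,eu), the two terms of
    [mdot_curv_proj] are opposite and are subtracted. *)
Lemma ricci_equation (N V : R * R -> 'rV[R]_n) q :
  smooth U N -> smooth U V -> normal_field N -> normal_field V -> U q ->
  mdot (curvN x X1 X2 N q) (V q) =
  2 * (- E q)^-1 / E q *
    (mdot (N q) (sff eu ev q) * mdot (V q) (sff eu eu q)
     - mdot (N q) (sff eu eu q) * mdot (V q) (sff eu ev q)).
Proof.
move=> sN sV nN nV Uq.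
have VC z (a : 'rV[R]_n) : U z -> mdot (a *m tangent_proj x z) (V z) = 0.
  by move=> Uz; have [Vu Vv] := nV z Uz; exact (mdot_tangent a Uz Vu Vv).
have VP z (a : 'rV[R]_n) : U z -> mdot (a *m normal_proj x z) (V z) = mdot a (V z).
  by move=> Uz; rewrite [in RHS](tangent_add_normal a Uz) mdotDl VC // add0r.
have NT z (a : 'rV[R]_n) : U z ->
    a *m normal_proj x z = a - a *m tangent_proj x z.
  move=> Uz; apply/eqP; rewrite eq_sym subr_eq addrC; apply/eqP.
  exact: tangent_add_normal.
have := mdot_curv_proj openU sc NT (smooth_tangent openU sx iso) sN sV VP VC Uq.
rewrite -[mdot (curv_of _ _ _ _ q) _]/(mdot (curvN x X1 X2 N q) (V q)) => ->.
rewrite (nablaYE _ sN Uq) (nablaXE _ sV Uq) (nablaXE _ sN Uq) (nablaYE _ sV Uq).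
apply: etrans (f_equal2 (fun a b : R => a - b)
  (mdot_tangent_proj (c q *: dv N q) (c q *: du V q) Uq)
  (mdot_tangent_proj (c q *: du N q) (c q *: dv V q) Uq)) _.
have Nuu := mdot_derive_normal eu eu sN nN Uq.
have Nuv := mdot_derive_normal eu ev sN nN Uq.
have Nvu := etrans (mdot_derive_normal ev eu sN nN Uq)
  (congr1 (fun a => - mdot (N q) a) (sff_sym Uq)).
have Nvv := etrans (mdot_derive_normal ev ev sN nN Uq)
  (congr1 (fun a => - mdot (N q) a) (minimal_second_ff openU sx iso min Uq)).
have Vuu := mdot_derive_normal eu eu sV nV Uq.
have Vuv := mdot_derive_normal eu ev sV nV Uq.
have Vvu := etrans (mdot_derive_normal ev eu sV nV Uq)
  (congr1 (fun a => - mdot (V q) a) (sff_sym Uq)).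
have Vvv := etrans (mdot_derive_normal ev ev sV nV Uq)
  (congr1 (fun a => - mdot (V q) a) (minimal_second_ff openU sx iso min Uq)).
move: (conformal_factor_sqr iso Uq) Nuu Nuv Nvu Nvv Vuu Vuv Vvu Vvv.
change ('D_eu x q) with (du x q); change ('D_ev x q) with (dv x q).
change ('D_eu N q) with (du N q); change ('D_ev N q) with (dv N q).
change ('D_eu V q) with (du V q); change ('D_ev V q) with (dv V q).
move: (sff eu eu q) (sff eu ev q) (du x q) (dv x q) (du N q) (dv N q) (du V q)
  (dv V q) (N q) (V q) (c q) (E q) => a b e f Nu Nv Vu Vv N0 V0 k l.
rewrite !mdotZl => <- -> -> -> -> -> -> -> ->.
by ring.
Qed.

End Curvature.

(** * Canonical coordinates *)

Lemma open_pos (R : realType) (D : set (R * R)) (g : R * R -> R) :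
  open D -> smooth D g -> open (D `&` [set q | 0 < g q]).
Proof.
move=> oD sg; rewrite openE => q [Dq gq]; apply: filterI.
  exact: open_nbhs_nbhs.
have cg : {for q, continuous g}.
  exact/differentiable_continuous/(smooth_differentiable sg Dq).
exact: (cvgr_gt _ cg).
Qed.

Section Canonical.
Variables (R : realType) (n : nat) (U : set (R * R)) (x : R * R -> 'rV[R]_n).
Hypotheses (openU : open U) (sx : smooth U x) (iso : isothermal x U).
Hypothesis min : minimal x U.
Implicit Types q : R * R.
Local Notation E := (metricE x).
Local Notation c := (conformal_factor x).
Local Notation sff v w := (second_ff x (cst v) (cst w)).

Lemma canonical_sff q : U q ->
  (let a := dnormal_part x q (ddt (Phi x) q) in mdot a a = 1) ->
  mdot (sff eu eu q) (sff eu eu q) + mdot (sff eu ev q) (sff eu ev q) = 1 /\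
  mdot (sff eu eu q) (sff eu ev q) = 0.
Proof.
move=> Uq.
(* Both components of Phi' are averages of two vectors with the same normal part: x_uu and x_vv by
   minimality, the two mixed derivatives by symmetry. *)
have half (a b : 'rV[R]_n) (M : 'M[R]_n) : b *m M = a *m M ->
    (2^-1 *: (a + b)) *m M = a *m M.
  move=> ba; rewrite -scalemxAl mulmxDl ba.
  have -> : a *m M + a *m M = (2 : R) *: (a *m M) by rewrite scaler_nat mulr2n.
  by rewrite scalerA mulVf ?scale1r // pnatr_eq0.
have A : (2^-1 *: (du (du x) q + dv (dv x) q)) *m normal_proj x q = sff eu eu q.
  exact: half (minimal_second_ff openU sx iso min Uq).
have B : (2^-1 *: (du (dv x) q + dv (du x) q)) *m normal_proj x q = sff eu ev q.
  exact: half (sff_sym openU sx Uq).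
have D : dnormal_part x q (ddt (Phi x) q) = dvec (sff eu eu q) (sff eu ev q) :=
  etrans (congr1 (mulmx^~ _) (ddt_PhiE x q))
    (etrans (dvec_mul _ _ _) (f_equal2 (@dvec R n) A B)).
move=> /(etrans (esym (congr1 (fun a => mdot a a) D))).
move: (sff eu eu q) (sff eu ev q) => a b; rewrite mdot_dvec => -[-> /eqP].
by rewrite mulf_eq0 pnatr_eq0 /= => /eqP ->.
Qed.

(** Writing w = c (y, z), the condition w^2 = 1 becomes z^2 - y^2 = 1 because x_v is the space-like
    direction, and the coefficients y^2 and z^2 merge because sigma(ev,ev) = sigma(eu,eu). *)
Lemma normal_curvature_setE q : U q ->
  normal_curvature_set x q =
  double_angle_set ((- E q)^-1 *: sff eu eu q) ((- E q)^-1 *: sff eu ev q).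
Proof.
move=> Uq; have c0 := conformal_factor_gt0 iso Uq.
have c2 := conformal_factor_sqr iso Uq.
have E0 := iso_E0 iso Uq.
have val (w : R * R) := etrans (second_ff_quadratic openU sx w Uq)
  (congr1 (fun a => _ + _ + w.2 ^+ 2 *: a) (minimal_second_ff openU sx iso min Uq)).
have met w : induced_metric x (cst w) (cst w) q = (w.2 ^+ 2 - w.1 ^+ 2) * - E q.
  rewrite /induced_metric /push /cst.
  apply: etrans (f_equal2 (@mdot R n) (derive_push sx w Uq) (derive_push sx w Uq)) _.
  move: (iso_uu x q) (iso_vv iso Uq) (iso_uv iso Uq).
  move: (du x q) (dv x q) (E q) => e f k ee ff ef.
  by rewrite !mdot_lin (mdotC f) ee ff ef; ring.
move: c0 c2 E0 val met.
move: (sff eu eu q) (sff eu ev q) (c q) (E q) => a b k e k0 k2 e0 val met.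
have en : - e != 0 by rewrite oppr_eq0 lt_eqF.
rewrite -k2; apply/seteqP; split=> v.
  move=> [w + <-]; rewrite /mkset met => w1.
  exists (w.1 / k), (w.2 / k); split.
    rewrite !expr_div_n k2 invrK -mulrBl; exact: w1.
  rewrite val !scalerA addrAC -scalerDl.
  by congr (_ *: _ + _ *: _); field; rewrite gt_eqF.
move=> [y [z [yz ->]]].
exists (k * y, k * z) => /=.
  by rewrite met /= !exprMn -mulrBr yz mulr1 k2 mulVf.
rewrite val /= !scalerA addrAC -scalerDl.
by congr (_ *: _ + _ *: _); ring.
Qed.

End Canonical.

Lemma smooth_normalize (R : realType) (n : nat) (U : set (R * R))
    (s : R * R -> 'rV[R]_n) :
  open U -> smooth U s -> (forall q, U q -> 0 < mdot (s q) (s q)) ->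
  smooth U (fun q => (mnorm (s q))^-1 *: s q).
Proof.
move=> oU ss s0; have sss := smooth_mdot oU ss ss.
apply: (smoothZ oU) => //; apply: (smoothV oU); last exact: smooth_sqrt.
by move=> q Uq; rewrite gt_eqF // sqrtr_gt0 s0.
Qed.

Lemma mdotZl_eq0 (R : comNzRingType) n k (a b : 'rV[R]_n) :
  mdot a b = 0 -> mdot (k *: a) b = 0.
Proof. by move=> ab; rewrite mdotZl ab mulr0. Qed.

Lemma mdot_scale2 (R : comNzRingType) n k (u v a b : 'rV[R]_n) :
  u = k *: a -> v = k *: b -> mdot u v = k ^+ 2 * mdot a b.
Proof. by move=> -> ->; rewrite mdotZl mdotZr mulrA expr2. Qed.

Lemma normalized_ricci_value (R : realType) n (E nu mu : R) (a b n1 n2 : 'rV[R]_n) :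
  E < 0 -> 0 < nu -> 0 < mu ->
  n1 = (nu^-1 * (- E)^-1) *: a -> n2 = (mu^-1 * (- E)^-1) *: b -> mdot a b = 0 ->
  nu ^+ 2 = (- E)^-1 ^+ 2 * mdot a a -> mu ^+ 2 = (- E)^-1 ^+ 2 * mdot b b ->
  2 * (- E)^-1 / E * (mdot n1 b * mdot n2 a - mdot n1 a * mdot n2 b) = 2 * nu * mu.
Proof.
move=> E0 nu0 mu0 -> -> ab nu2 mu2; rewrite !mdotZl (mdotC b) ab.
have En : E != 0 by rewrite lt_eqF.
have -> : mdot a a = (- E) ^+ 2 * nu ^+ 2 by rewrite nu2; field.
have -> : mdot b b = (- E) ^+ 2 * mu ^+ 2 by rewrite mu2; field.
by field; rewrite En !gt_eqF.
Qed.

(* With k = -1/E, both closed forms for E say nu^2 + mu^2 = k^2. *)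
Lemma canonical_factor_from_norms (R : realType) (E nu mu K kappa : R) :
  E < 0 -> nu ^+ 2 + mu ^+ 2 = (- E)^-1 ^+ 2 ->
  K = - nu ^+ 2 + mu ^+ 2 -> kappa = 2 * nu * mu ->
  E = -1 / Num.sqrt (mu ^+ 2 + nu ^+ 2) /\
  E = -1 / (K ^+ 2 + kappa ^+ 2) `^ (4^-1).
Proof.
move=> E0 nm -> ->; have En : E != 0 by rewrite lt_eqF.
have k0 : 0 < (- E)^-1 by rewrite invr_gt0 oppr_gt0.
have -> : (- nu ^+ 2 + mu ^+ 2) ^+ 2 + (2 * nu * mu) ^+ 2 =
    (nu ^+ 2 + mu ^+ 2) ^+ 2 by ring.
rewrite [mu ^+ 2 + _]addrC nm sqrtr_sqr gtr0_norm // -exprM.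
rewrite -powR_mulrn ?ltW // -powRrM mulfV ?pnatr_eq0 // powRr1 ?ltW //.
by split; field.
Qed.

Theorem mainTheorem3 (R : realType) (n : nat)
    (D : set (R * R)) (x : R * R -> 'rV[R]_n)
    (surface_x : timelike_surface x D)
    (minimal_x : minimal x D)
    (canonical_x : canonical_coordinates x D)
    (p : R * R) (Dp : D p) :
  let X1 := fun q => (Num.sqrt (- metricE x q))^-1 *: eu in
  let X2 := fun q => (Num.sqrt (- metricE x q))^-1 *: ev in
  let s11 := second_ff x X1 X1 in
  let s12 := second_ff x X1 X2 in
  s11 p <> 0 -> s12 p <> 0 ->
  let nu := fun q => mnorm (s11 q) in
  let mu := fun q => mnorm (s12 q) in
  let n1 := fun q => (nu q)^-1 *: s11 q in
  let n2 := fun q => (mu q)^-1 *: s12 q in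
  let kappa := mdot (curvN x X1 X2 n1 p) (n2 p) in
  let K := gauss_curvature x X1 X2 p in
  [/\ 0 < nu p /\ 0 < mu p,
      mdot (n1 p) (n2 p) = 0,
      exists h : hyperbola R n, normal_curvature_hyperbola x p h,
      forall h : hyperbola R n, normal_curvature_hyperbola x p h ->
        [/\ real_axis h (s11 p), nu p = real_semiaxis h,
            conjugate_axis h (s12 p) & mu p = conjugate_semiaxis h] &
      [/\ K = - nu p ^+ 2 + mu p ^+ 2,
          kappa = 2 * nu p * mu p \/ kappa = - (2 * nu p * mu p),
          metricE x p = -1 / Num.sqrt (mu p ^+ 2 + nu p ^+ 2) &
          metricE x p = -1 / (K ^+ 2 + kappa ^+ 2) `^ (4^-1)]].
Proof.
move=> X1 X2 s11 s12 s11_neq0 s12_neq0 nu mu n1 n2 kappa K.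
case: surface_x => [[openD _ _] sx _ _]; case: canonical_x => iso can.
pose A := second_ff x (cst eu) (cst eu); pose B := second_ff x (cst eu) (cst ev).
have s11E q (Dq : D q) : s11 q = (- metricE x q)^-1 *: A q :=
  second_ff_frame openD sx iso eu eu Dq.
have s12E q (Dq : D q) : s12 q = (- metricE x q)^-1 *: B q :=
  second_ff_frame openD sx iso eu ev Dq.
have [AABB AB] := canonical_sff openD sx iso minimal_x Dp (can p Dp).
have E0 := iso_E0 iso Dp.
have orth Y Z q (Dq : D q) : mdot (second_ff x Y Z q) (du x q) = 0 /\
    mdot (second_ff x Y Z q) (dv x q) = 0 := normal_proj_orth iso _ Dq.
(* A nonzero vector orthogonal to the time-like x_u is space-like, so the norms are genuine square
   roots of positive numbers. *)
have aa : 0 < mdot (s11 p) (s11 p) :=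
  @timelike_orthogonal_gt0 R n (du x p) (s11 p) E0 (orth X1 X1 p Dp).1
    (introN eqP s11_neq0).
have bb : 0 < mdot (s12 p) (s12 p) :=
  @timelike_orthogonal_gt0 R n (du x p) (s12 p) E0 (orth X1 X2 p Dp).1
    (introN eqP s12_neq0).
have ab : mdot (s11 p) (s12 p) = 0.
  apply: etrans (mdot_scale2 (s11E p Dp) (s12E p Dp)) _.
  by rewrite [X in _ * X]AB mulr0.
have hyp : normal_curvature_set x p = double_angle_set (s11 p) (s12 p).
  rewrite (s11E _ Dp) (s12E _ Dp).
  exact (normal_curvature_setE openD sx iso minimal_x Dp).
have nu0 : 0 < nu p := mnorm_gt0 aa.
have mu0 : 0 < mu p := mnorm_gt0 bb.
have nu2 : nu p ^+ 2 = (- metricE x p)^-1 ^+ 2 * mdot (A p) (A p) :=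
  etrans (mnorm_sqr aa) (mdot_scale2 (s11E p Dp) (s11E p Dp)).
have mu2 : mu p ^+ 2 = (- metricE x p)^-1 ^+ 2 * mdot (B p) (B p) :=
  etrans (mnorm_sqr bb) (mdot_scale2 (s12E p Dp) (s12E p Dp)).
have KE : K = - nu p ^+ 2 + mu p ^+ 2.
  apply: etrans (gauss_equation openD sx iso minimal_x Dp) _.
  apply: etrans _ (esym (f_equal2 (fun a b : R => - a + b) nu2 mu2)).
  by rewrite mulrBr addrC.
have kappaE : kappa = 2 * nu p * mu p.
  have sE : smooth D (fun q => (- metricE x q)^-1).
    apply: (smoothV openD); last exact (smoothN openD (smooth_E openD sx)).
    by move=> q Dq; rewrite oppr_eq0 (lt_eqF (iso_E0 iso Dq)).
  have ss11 : smooth D s11 := smooth_ext openD (fun q Dq => esym (s11E q Dq))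
    (smoothZ openD sE (smooth_sff_uu openD sx iso)).
  have ss12 : smooth D s12 := smooth_ext openD (fun q Dq => esym (s12E q Dq))
    (smoothZ openD sE (smooth_sff_uv openD sx iso)).
  (* Where sigma(X1,X1) or sigma(X1,X2) vanishes, the inverse of the norm takes the default value 0
     and smoothness of n1 or n2 may fail. This open set avoids such points and contains p, and
     curvature at p depends only on a neighbourhood. *)
  pose U := (D `&` [set q | 0 < mdot (s11 q) (s11 q)]) `&`
            (D `&` [set q | 0 < mdot (s12 q) (s12 q)]).
  have openU : open U.
    by apply: openI; apply: open_pos => //; exact: smooth_mdot.
  have UD : U `<=` D by move=> q [[]].
  have sUx := smooth_sub UD sx.
  have sn1 : smooth U n1.
    apply: (smooth_normalize openU (smooth_sub UD ss11)).
    by move=> q [[_ +] _].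
  have sn2 : smooth U n2.
    apply: (smooth_normalize openU (smooth_sub UD ss12)).
    by move=> q [_ [_ +]].
  have nn1 : normal_field U x n1.
    move=> q /UD Dq; have [su sv] := orth X1 X1 q Dq.
    exact (conj (mdotZl_eq0 _ su) (mdotZl_eq0 _ sv)).
  have nn2 : normal_field U x n2.
    move=> q /UD Dq; have [su sv] := orth X1 X2 q Dq.
    exact (conj (mdotZl_eq0 _ su) (mdotZl_eq0 _ sv)).
  have Up : U p := conj (conj Dp aa) (conj Dp bb).
  apply: etrans (ricci_equation openU sUx (fun q Uq => iso q (UD q Uq))
    (fun q w1 w2 Uq => minimal_x q w1 w2 (UD q Uq)) sn1 sn2 nn1 nn2 Up) _.
  have n1E := etrans (congr1 ( *:%R (nu p)^-1) (s11E p Dp)) (scalerA _ _ _).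
  have n2E := etrans (congr1 ( *:%R (mu p)^-1) (s12E p Dp)) (scalerA _ _ _).
  exact (normalized_ricci_value E0 nu0 mu0 n1E n2E AB nu2 mu2).
have nm : nu p ^+ 2 + mu p ^+ 2 = (- metricE x p)^-1 ^+ 2.
  apply: etrans (f_equal2 +%R nu2 mu2) _.
  by rewrite -mulrDr [X in _ * X]AABB mulr1.
have [Esqrt Epow] := canonical_factor_from_norms E0 nm KE kappaE.
split; first by [].
- exact (mdotZl_eq0 _ (etrans (mdotC _ _)
    (mdotZl_eq0 _ (etrans (mdotC _ _) ab)))).
- exists (axes_hyperbola aa bb ab), false.
  by rewrite hyp double_angle_branch.
- by move=> h [neg]; rewrite hyp; exact: branch_axes.
(* For n1 and n2 built from sigma in this frame, the sign of kappa is always plus. *)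
- by split=> //; left.
Qed.
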